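(* Let $K/\mathbb{Q}$ be a CM-field with maximal totally real subfield $K^+$, Galois closure $K^\sharp$ over $\mathbb{Q}$, $G=\mathrm{Gal}(K^\sharp/\mathbb{Q})$, and $N_2=\mathrm{Gal}(K^\sharp/K)$. Let $\mathbf{T}$ be the algebraic torus over $\mathbb{Q}$ $$\mathbf{T}=\mathrm{Ker}\left(\mathbb{G}_m\times_{\mathrm{Spec}(\mathbb{Q})}\mathbf{R}_{K/\mathbb{Q}}(\mathbb{G}_m)\xrightarrow{(x,y)\mapsto x^{-1}N_{K/K^+}(y)}\mathbf{R}_{K^+/\mathbb{Q}}(\mathbb{G}_m)\right).$$ Then $\hat H^1(\mathbb{Q},\mathbf{X}^\star(\mathbf{T}))$ is isomorphic to a subgroup of $\mathbb{Z}/2\mathbb{Z}$. Moreover, $\hat H^1(\mathbb{Q},\mathbf{X}^\star(\mathbf{T}))=0$ if and only if there is $g\in G$ such that the number of double cosets $|\langle g\rangle\backslash G/N_2|$ is odd.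
   Context: $\mathbf{R}_{E/\mathbb{Q}}$ denotes Weil restriction of scalars. $\mathbf{X}^\star(\mathbf{T})$ is the character lattice of $\mathbf{T}$, a $G$-module since $\mathbf{T}$ splits over $K^\sharp$, and $\hat H^1(\mathbb{Q},\mathbf{X}^\star(\mathbf{T}))$ means the Tate cohomology group $\hat H^1(G,\mathbf{X}^\star(\mathbf{T}))$. $K$ is not assumed Galois over $\mathbb{Q}$. *)

(* Defs.v *)
From HB Require Import structures.
From mathcomp Require Import all_boot all_order all_fingroup all_algebra.
From mathcomp Require Import all_solvable all_field.
From mathcomp Require Import boolp.

Set Implicit Arguments.
Unset Strict Implicit.
Unset Printing Implicit Defensive.

Import GRing.Theory.
Local Open Scope ring_scope.

(* The multiplicative group R^* of a commutative ring, i.e. G_m(R).  A unit   *)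
(* is stored with its inverse, which is unique, so that no decidability of    *)
(* invertibility is needed.                                                   *)
Section Gm.
Variable R : comNzRingType.

Record Gm := MkGm { Gm_pair : R * R; _ : Gm_pair.1 * Gm_pair.2 == 1 }.
HB.instance Definition _ := [isSub for Gm_pair].
HB.instance Definition _ := [Choice of Gm by <:].

Definition Gm_val (u : Gm) : R := (Gm_pair u).1.

Lemma Gm_valVr (u : Gm) : (Gm_pair u).1 * (Gm_pair u).2 = 1.
Proof. by case: u => p /= /eqP. Qed.

Lemma Gm_val_inj : injective Gm_val.
Proof.
move=> u v; rewrite /Gm_val => e; apply: val_inj => /=.
have := Gm_valVr u; have := Gm_valVr v; move: e.
case: (Gm_pair u) (Gm_pair v) => [a a'] [b b'] /= -> hb ha.
by congr (_, _); rewrite -[a']mulr1 -hb mulrCA mulrA ha mul1r.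
Qed.

Fact Gm_one_proof : (1 : R, 1 : R).1 * (1 : R, 1 : R).2 == 1.
Proof. by rewrite mulr1. Qed.
Definition Gm_one := MkGm Gm_one_proof.

Fact Gm_inv_proof (u : Gm) :
  ((Gm_pair u).2, (Gm_pair u).1).1 * ((Gm_pair u).2, (Gm_pair u).1).2 == 1.
Proof. by rewrite /= mulrC Gm_valVr. Qed.
Definition Gm_inv u := MkGm (Gm_inv_proof u).

Fact Gm_mul_proof (u v : Gm) :
  let p := ((Gm_pair u).1 * (Gm_pair v).1, (Gm_pair u).2 * (Gm_pair v).2) in
  p.1 * p.2 == 1.
Proof. by rewrite /= mulrACA !Gm_valVr mulr1. Qed.
Definition Gm_mul u v := MkGm (Gm_mul_proof u v).

Fact Gm_mulA : associative Gm_mul.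
Proof. by move=> u v w; apply: Gm_val_inj; rewrite /Gm_val /= mulrA. Qed.
Fact Gm_mulC : commutative Gm_mul.
Proof. by move=> u v; apply: Gm_val_inj; rewrite /Gm_val /= mulrC. Qed.
Fact Gm_mul1 : left_id Gm_one Gm_mul.
Proof. by move=> u; apply: Gm_val_inj; rewrite /Gm_val /= mul1r. Qed.
Fact Gm_mulr1 : right_id Gm_one Gm_mul.
Proof. by move=> u; rewrite Gm_mulC Gm_mul1. Qed.
Fact Gm_mulV : left_inverse Gm_one Gm_inv Gm_mul.
Proof.
by move=> u; apply: Gm_val_inj; rewrite /Gm_val /= mulrC Gm_valVr.
Qed.
Fact Gm_mulrV : right_inverse Gm_one Gm_inv Gm_mul.
Proof. by move=> u; rewrite Gm_mulC Gm_mulV. Qed.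

HB.instance Definition _ :=
  isGroup.Build Gm Gm_mulA Gm_mul1 Gm_mulr1 Gm_mulV Gm_mulrV.

Lemma Gm_valM (u v : Gm) : Gm_val (u * v)%g = Gm_val u * Gm_val v.
Proof. by []. Qed.

Lemma Gm_val1 : Gm_val 1%g = 1. Proof. by []. Qed.

Lemma Gm_commute (u v : Gm) : (u * v = v * u)%g.
Proof. exact: Gm_mulC. Qed.

End Gm.

Section GmMap.
Variables (R S : comNzRingType) (f : R -> S).
Hypothesis fM : GRing.monoid_morphism f.

Fact Gm_map_proof (u : Gm R) :
  (f (Gm_pair u).1, f (Gm_pair u).2).1
    * (f (Gm_pair u).1, f (Gm_pair u).2).2 == 1.
Proof. by rewrite /= -fM.2 Gm_valVr fM.1. Qed.
Definition Gm_map u : Gm S := MkGm (Gm_map_proof u).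

Lemma Gm_mapE u : Gm_val (Gm_map u) = f (Gm_val u). Proof. by []. Qed.

Lemma Gm_mapM : {morph Gm_map : u v / (u * v)%g}.
Proof. by move=> u v; apply: Gm_val_inj; rewrite Gm_mapE !Gm_valM fM.2. Qed.

Lemma Gm_map1 : Gm_map 1%g = 1%g.
Proof. by apply: Gm_val_inj; rewrite Gm_mapE !Gm_val1 fM.1. Qed.

Lemma Gm_mapV : {morph Gm_map : u / (u^-1)%g}.
Proof. by move=> u; apply: Gm_val_inj. Qed.

End GmMap.

(* The F-algebra E (x)_F A, for E/F finite and A a commutative F-algebra:     *)
(* the vector u stands for \sum_i b_i (x) u_i, with b = vbasis {:E}.          *)
Section Tensor.
Variables (F : fieldType) (E : fieldExtType F).

Definition tensor (A : comAlgType F) : Type := 'rV[A]_(\dim {:E}).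

Local Notation n := (\dim {:E}).
Local Notation b := (vbasis {:E}).

Section Ring.
Variable A : comAlgType F.
HB.instance Definition _ := GRing.Zmodule.on (tensor A).

Definition pure (e : E) (a : A) : tensor A := \row_k (coord b k e *: a).

Definition tensor_mul (u v : tensor A) : tensor A :=
  \sum_(i < n) \sum_(j < n) pure (b`_i * b`_j) (u 0 i * v 0 j).

Lemma pureDl a : {morph pure^~ a : x y / x + y}.
Proof. by move=> x y; apply/rowP=> k; rewrite !mxE linearD scalerDl. Qed.
Lemma pureDr e : {morph pure e : x y / x + y}.
Proof. by move=> x y; apply/rowP=> k; rewrite !mxE scalerDr. Qed.
Lemma pureZ c e a : pure (c *: e) a = pure e (c *: a).
Proof. by apply/rowP=> k; rewrite !mxE linearZ /= mulrC scalerA. Qed.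
Lemma pure0l a : pure 0 a = 0.
Proof. by apply/rowP=> k; rewrite !mxE linear0 scale0r. Qed.
Lemma pure0r e : pure e 0 = 0.
Proof. by apply/rowP=> k; rewrite !mxE scaler0. Qed.
Lemma pure_suml (I : Type) (r : seq I) (P : pred I) (G : I -> E) a :
  pure (\sum_(i <- r | P i) G i) a = \sum_(i <- r | P i) pure (G i) a.
Proof. exact: (big_morph (pure^~ a) (pureDl a) (pure0l a)). Qed.
Lemma pure_sumr (I : Type) (r : seq I) (P : pred I) (G : I -> A) e :
  pure e (\sum_(i <- r | P i) G i) = \sum_(i <- r | P i) pure e (G i).
Proof. exact: (big_morph (pure e) (pureDr e) (pure0r e)). Qed.

Lemma tensorE (u : tensor A) : u = \sum_(i < n) pure b`_i (u 0 i).
Proof.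
apply/rowP=> k; rewrite summxE (bigD1 k) //= mxE.
rewrite (coord_free _ _ (basis_free (vbasisP _))) eqxx scale1r.
rewrite big1 ?addr0 // => i /negbTE ik; rewrite mxE.
by rewrite (coord_free _ _ (basis_free (vbasisP _))) ik scale0r.
Qed.

Lemma pure_ind (P : tensor A -> Prop) :
  P 0 -> (forall u v, P u -> P v -> P (u + v)) ->
  (forall e a, P (pure e a)) -> forall u, P u.
Proof. by move=> P0 PD Pp u; rewrite [u]tensorE; apply: big_ind. Qed.

Fact tensor_mulDl : left_distributive tensor_mul +%R.
Proof.
move=> u v w; rewrite /tensor_mul -big_split /=; apply: eq_bigr => i _.
by rewrite -big_split /=; apply: eq_bigr => j _; rewrite mxE mulrDl pureDr.
Qed.

Fact tensor_mulC : commutative tensor_mul.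
Proof.
move=> u v; rewrite /tensor_mul exchange_big /=; apply: eq_bigr => i _.
by apply: eq_bigr => j _; rewrite mulrC [_ * u _ _]mulrC.
Qed.

Fact tensor_mulDr : right_distributive tensor_mul +%R.
Proof. by move=> u v w; rewrite !(tensor_mulC u) tensor_mulDl. Qed.

Fact tensor_mul0l u : tensor_mul 0 u = 0.
Proof.
by apply: (addrI (tensor_mul 0 u)); rewrite -tensor_mulDl !addr0.
Qed.

Fact tensor_mul0r u : tensor_mul u 0 = 0.
Proof. by rewrite tensor_mulC tensor_mul0l. Qed.

Lemma tensor_mul_pure e a e' a' :
  tensor_mul (pure e a) (pure e' a') = pure (e * e') (a * a').
Proof.
rewrite {2}(coord_vbasis (memvf e)) {2}(coord_vbasis (memvf e')).
rewrite mulr_suml pure_suml; apply: eq_bigr => i _.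
rewrite mulr_sumr pure_suml; apply: eq_bigr => j _.
rewrite !mxE -!scalerAl -!scalerAr !pureZ !scalerA.
by congr (pure _ (_ *: _)); rewrite mulrC.
Qed.

Fact tensor_mulA : associative tensor_mul.
Proof.
move=> u v w; move: u; apply: pure_ind => [|u u' hu hu'|e a].
- by rewrite !tensor_mul0l.
- by rewrite !tensor_mulDl hu hu'.
move: v; apply: pure_ind => [|v v' hv hv'|e' a'].
- by rewrite !(tensor_mul0l, tensor_mul0r).
- by rewrite !(tensor_mulDl, tensor_mulDr) hv hv'.
move: w; apply: pure_ind => [|w w' hw hw'|e'' a''].
- by rewrite !tensor_mul0r.
- by rewrite !tensor_mulDr hw hw'.
by rewrite !tensor_mul_pure !mulrA.
Qed.

Fact tensor_mul1 : left_id (pure 1 1) tensor_mul.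
Proof.
apply: pure_ind => [|u u' hu hu'|e a].
- by rewrite tensor_mul0r.
- by rewrite tensor_mulDr hu hu'.
by rewrite tensor_mul_pure !mul1r.
Qed.

Fact tensor_oner_neq0 : pure 1 1 != 0.
Proof.
apply/eqP => e0; have /negP[] := oner_neq0 E; apply/eqP.
rewrite (coord_vbasis (memvf (1 : E))) big1 // => k _.
have /rowP/(_ k) := e0; rewrite !mxE => /eqP.
by rewrite scaler_eq0 oner_eq0 orbF => /eqP ->; rewrite scale0r.
Qed.

HB.instance Definition _ := GRing.Zmodule_isComNzRing.Build (tensor A)
  tensor_mulA tensor_mulC tensor_mul1 tensor_mulDl tensor_oner_neq0.

Lemma pureM e a e' a' : pure e a * pure e' a' = pure (e * e') (a * a').
Proof. exact: tensor_mul_pure. Qed.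

Lemma pure11 : pure 1 1 = 1. Proof. by []. Qed.

Fact pure1_monoid_morphism : GRing.monoid_morphism (pure 1).
Proof. by split=> [|a a'] //; rewrite pureM mul1r. Qed.

End Ring.
End Tensor.

Section TensorMap.
Variables (F : fieldType) (E : fieldExtType F) (A B : comAlgType F).
Variable f : {lrmorphism A -> B}.

Definition tensor_map (u : tensor E A) : tensor E B := map_mx f u.

Lemma tensor_map_pure e a : tensor_map (pure e a) = pure e (f a).
Proof. by apply/rowP=> k; rewrite !mxE linearZ. Qed.

Fact tensor_map_zmod_morphism : zmod_morphism tensor_map.
Proof. by move=> u v; rewrite /tensor_map raddfB. Qed.
HB.instance Definition _ :=
  GRing.isZmodMorphism.Build _ _ tensor_map tensor_map_zmod_morphism.

Lemma tensor_mapD : {morph tensor_map : u v / u + v}.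
Proof. exact: raddfD. Qed.
Lemma tensor_map0 : tensor_map 0 = 0.
Proof. exact: raddf0. Qed.

Fact tensor_map_monoid_morphism : GRing.monoid_morphism tensor_map.
Proof.
split=> [|u v]; first by rewrite -!pure11 tensor_map_pure rmorph1.
move: u; apply: pure_ind => [|u u' hu hu'|e a].
- by rewrite mul0r tensor_map0 mul0r.
- by rewrite mulrDl !tensor_mapD mulrDl hu hu'.
move: v; apply: pure_ind => [|v v' hv hv'|e' a'].
- by rewrite mulr0 tensor_map0 mulr0.
- by rewrite mulrDr !tensor_mapD mulrDr hv hv'.
by rewrite pureM !tensor_map_pure pureM rmorphM.
Qed.
HB.instance Definition _ :=
  GRing.isMonoidMorphism.Build _ _ tensor_map tensor_map_monoid_morphism.

End TensorMap.

(* h (x) id_A, for h : E -> E' an F-linear map. *)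
Section BaseChange.
Variables (F : fieldType) (E E' : fieldExtType F) (A : comAlgType F).

Definition base_change (h : E -> E') (u : tensor E A) : tensor E' A :=
  \sum_(i < \dim {:E}) pure (h (vbasis {:E})`_i) (u 0 i).

Lemma base_changeD h : {morph base_change h : u v / u + v}.
Proof.
move=> u v; rewrite /base_change -big_split /=; apply: eq_bigr => i _.
by rewrite mxE pureDr.
Qed.

Lemma base_change_pure (h : E -> E') (hl : linear h) e a :
  base_change h (pure e a) = pure (h e) a.
Proof.
pose h' := GRing.isLinear.Build _ _ _ _ h hl.
pose H : {linear E -> E'} := HB.pack h h'.
rewrite /base_change {2}(coord_vbasis (memvf e)) -[h]/(H : E -> E').
rewrite linear_sum pure_suml; apply: eq_bigr => i _.
by rewrite linearZ /= pureZ mxE.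
Qed.

End BaseChange.

(* The norm of an extension K/K0 of subfields K0 <= K of L is the determinant *)
(* of multiplication on the K0-vector space K.  Its matrix M has entries the  *)
(* F-linear maps M i j : K -> K0 below, so that M (x) id_A is the matrix of   *)
(* multiplication on K (x) A over K0 (x) A, and its determinant is the norm   *)
(* of K (x) A over K0 (x) A.                                                  *)
Section Norm.
Variables (F : fieldType) (L : fieldExtType F) (K0 K : {subfield L}).

Local Notation m := (\dim (vspaceOver K0 K)).
Local Notation b := (vbasis (vspaceOver K0 K)).

Definition mult_mx (i j : 'I_m) (y : subvs_of K) : subvs_of K0 :=
  coord b j ((vsval y : fieldOver K0) * b`_i).

Definition tensor_norm (A : comAlgType F) (u : tensor (subvs_of K) A) :
    tensor (subvs_of K0) A :=
  \det (\matrix_(i, j) base_change (mult_mx i j) u).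

Fact mult_mx_linear i j : linear (mult_mx i j).
Proof.
move=> c y z; rewrite /mult_mx linearP mulrDl linearD /=; congr (_ + _).
have -> : (c *: vsval y : fieldOver K0) * b`_i
     = ((c%:A : subvs_of K0) *: ((vsval y : fieldOver K0) * b`_i)).
  by rewrite fieldOver_scaleE linearZ /= algid1 -scalerAl mul1r (@scalerAl _ L).
rewrite (linearZ_LR (coord b j)) /= -scalerAl mul1r//.
Qed.

Fact mult_mx_mem (y : subvs_of K) (i : 'I_m) :
  (vsval y : fieldOver K0) * b`_i \in vspaceOver K0 K.
Proof.
have : b`_i \in vspaceOver K0 K.
  by apply: vbasis_mem; rewrite mem_nth // size_tuple.
rewrite !mem_vspaceOver => bi; have := memv_mul (valP y) bi.
by rewrite prodvCA prodv_id.
Qed.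

Fact mult_mx1 i j : mult_mx i j 1 = (i == j)%:R.
Proof.
by rewrite /mult_mx rmorph1 mul1r (coord_free _ _ (basis_free (vbasisP _))).
Qed.

Fact mult_mxM y z i j :
  mult_mx i j (y * z) = \sum_k mult_mx i k y * mult_mx k j z.
Proof.
rewrite /mult_mx rmorphM /= [vsval y * _]mulrC -mulrA.
rewrite {1}(coord_vbasis (mult_mx_mem y i)) mulr_sumr linear_sum /=.
by apply: eq_bigr => k _; rewrite -scalerAr linearZ.
Qed.

Variables (A B : comAlgType F).

Fact tensor_mult_mxM (u v : tensor (subvs_of K) A) i j :
  base_change (mult_mx i j) (u * v) =
  \sum_k base_change (mult_mx i k) u * base_change (mult_mx k j) v.
Proof.
have z0 i' j' : base_change (mult_mx i' j') (0 : tensor (subvs_of K) A) = 0.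
  by rewrite -(pure0l _ 0) (base_change_pure (mult_mx_linear _ _)) pure0r.
move: u; apply: pure_ind => [|u u' hu hu'|e a].
- by rewrite mul0r z0 big1 // => k _; rewrite z0 mul0r.
- rewrite mulrDl base_changeD hu hu' -big_split /=; apply: eq_bigr => k _.
  by rewrite base_changeD mulrDl.
move: v; apply: pure_ind => [|v v' hv hv'|e' a'].
- by rewrite mulr0 z0 big1 // => k _; rewrite z0 mulr0.
- rewrite mulrDr base_changeD hv hv' -big_split /=; apply: eq_bigr => k _.
  by rewrite base_changeD mulrDr.
rewrite pureM (base_change_pure (mult_mx_linear _ _)) mult_mxM pure_suml.
apply: eq_bigr => k _.
by rewrite !(base_change_pure (mult_mx_linear _ _)) pureM.
Qed.

Fact tensor_norm_monoid_morphism : GRing.monoid_morphism (@tensor_norm A).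
Proof.
split=> [|u v]; rewrite /tensor_norm.
  rewrite -[RHS](det1 _ m); congr (\det _); apply/matrixP=> i j; rewrite !mxE.
  rewrite -pure11 (base_change_pure (mult_mx_linear _ _)) mult_mx1.
  by case: (i == j); rewrite ?pure0l.
rewrite -det_mulmx; congr (\det _); apply/matrixP=> i j; rewrite !mxE.
by rewrite tensor_mult_mxM; apply: eq_bigr => k _; rewrite !mxE.
Qed.

Fact tensor_norm_map (f : {lrmorphism A -> B}) u :
  tensor_map f (tensor_norm u) = tensor_norm (tensor_map f u).
Proof.
rewrite /tensor_norm -det_map_mx; congr (\det _).
apply/matrixP=> i j; rewrite !mxE /base_change raddf_sum /=.
by apply: eq_bigr => k _; rewrite tensor_map_pure mxE.
Qed.

End Norm.

(* The group functor T = Ker (G_m x R_{K/F} G_m -> R_{K0/F} G_m), on points   *)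
(* in commutative (nonzero) F-algebras A, where R_{E/F} G_m (A) is            *)
(* G_m (E (x) A).                                                             *)
Section Torus.
Variables (F : fieldType) (L : fieldExtType F) (K0 K : {subfield L}).

Section Points.
Variable A : comAlgType F.

Definition torus_map (p : Gm A * Gm (tensor (subvs_of K) A)) :
    Gm (tensor (subvs_of K0) A) :=
  ((Gm_map (pure1_monoid_morphism (subvs_of K0) A) p.1)^-1
   * Gm_map (tensor_norm_monoid_morphism K0 K A) p.2)%g.

Definition torus_ker : {pred Gm A * Gm (tensor (subvs_of K) A)} :=
  [pred p | torus_map p == 1%g].

Record torus := Torus {
  torus_val : Gm A * Gm (tensor (subvs_of K) A);
  _ : torus_val \in torus_ker
}.
HB.instance Definition _ := [isSub for torus_val].
HB.instance Definition _ := [Choice of torus by <:].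

Fact torus_mapM : {morph torus_map : p q / (p * q)%g}.
Proof.
move=> p q; rewrite /torus_map !Gm_mapM invgM [(_^-1 * _^-1)%g]Gm_commute.
by apply: Gm_val_inj; rewrite !Gm_valM mulrACA.
Qed.

Lemma torus_kerP p : reflect (torus_map p = 1%g) (p \in torus_ker).
Proof. exact: eqP. Qed.

Fact torus_ker_closed : group_closed torus_ker.
Proof.
have t1 : torus_map 1%g = 1%g.
  by rewrite /torus_map !Gm_map1 invg1 mulg1.
split=> [|p q]; first exact/torus_kerP.
move=> /torus_kerP hp /torus_kerP hq; apply/torus_kerP.
have hV : torus_map q^-1%g = 1%g.
  by rewrite -[LHS]mulg1 -{1}hq -torus_mapM mulVg t1.
by rewrite torus_mapM hp hV mulg1.
Qed.
HB.instance Definition _ := SubChoice_isSubGroup.Build _ _ torus torus_ker_closed.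

End Points.

Section PointsMap.
Variables (A B : comAlgType F) (f : {lrmorphism A -> B}).

Let f1 : GRing.monoid_morphism f := (rmorph1 f, rmorphM f).

Definition torus_map_val (p : Gm A * Gm (tensor (subvs_of K) A)) :
    Gm B * Gm (tensor (subvs_of K) B) :=
  (Gm_map f1 p.1, Gm_map (tensor_map_monoid_morphism (subvs_of K) f) p.2).

Fact torus_map_val_ker (t : torus A) : torus_map_val (val t) \in @torus_ker B.
Proof.
case: t => p /= /torus_kerP tp; apply/torus_kerP; apply: Gm_val_inj.
have := congr1 (tensor_map f) (congr1 (@Gm_val _) tp).
rewrite !Gm_valM !Gm_val1 rmorph1 rmorphM /= => <-; congr (_ * _).
  by rewrite /Gm_val /= tensor_map_pure.
by rewrite !Gm_mapE tensor_norm_map.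
Qed.

Definition torus_fmap (t : torus A) : torus B :=
  Torus (torus_map_val_ker t).

End PointsMap.

Lemma torus_fmap_id (A : comAlgType F) (t : torus A) : torus_fmap idfun t = t.
Proof.
apply: val_inj; case: t => [[x y] /= _]; congr (_, _); apply: Gm_val_inj => //.
by rewrite Gm_mapE; apply/rowP=> i; rewrite mxE.
Qed.

End Torus.

Fact lrmorphism_monoid_morphism (F : fieldType) (A B : comAlgType F)
  (f : {lrmorphism A -> B}) : GRing.monoid_morphism f.
Proof. exact: (rmorph1 f, rmorphM f). Qed.

(* Abelian groups.  A character below quantifies over all algebras, so the    *)
(* type of characters lies in a universe strictly above that of the carriers  *)
(* of zmodType; this is zmodType without the universe restriction.            *)
Record abgroup := AbGroup {
  ab_sort :> Type;
  ab0 : ab_sort;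
  abN : ab_sort -> ab_sort;
  abD : ab_sort -> ab_sort -> ab_sort;
  abDA : associative abD;
  abDC : commutative abD;
  ab0D : left_id ab0 abD;
  abND : left_inverse ab0 abN abD
}.

Arguments ab0 {_}.

Declare Scope ab_scope.
Delimit Scope ab_scope with ab.
Notation "0" := ab0 : ab_scope.
Notation "x + y" := (abD x y) : ab_scope.
Notation "- x" := (abN x) : ab_scope.
Notation "x - y" := (abD x (abN y)) : ab_scope.

Section AbTheory.
Variable M : abgroup.
Implicit Types x y z t : M.
Local Open Scope ab_scope.

Lemma abD0 x : x + 0 = x. Proof. by rewrite abDC ab0D. Qed.
Lemma abDN x : x - x = 0. Proof. by rewrite abDC abND. Qed.
Lemma abNK x y : (x - y) + y = x. Proof. by rewrite -abDA abND abD0. Qed.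
Lemma abDI x y z : x + z = y + z -> x = y.
Proof. by move=> e; rewrite -[x]abD0 -[y]abD0 -(abDN z) !abDA e. Qed.
Lemma abACA x y z t : (x + y) + (z + t) = (x + z) + (y + t).
Proof. by rewrite -!abDA; congr (_ + _); rewrite abDC -abDA [t + y]abDC. Qed.
Lemma abND2 x y : - (x + y) = - x - y.
Proof. by apply: (abDI (z := x + y)); rewrite abACA !abND ab0D. Qed.
Lemma abN0 : - (0 : M) = 0. Proof. by rewrite -[LHS]abD0 abND. Qed.
Lemma abNN x : - - x = x.
Proof. by apply: (abDI (z := - x)); rewrite abDN abND. Qed.

End AbTheory.

(* Characters T_L -> G_m over L, as natural transformations of group functors *)
(* on commutative L-algebras.  An L-algebra is an F-algebra A together with   *)
(* its structure morphism phi : L -> A.                                       *)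
Section Characters.
Variables (F : fieldType) (L : fieldExtType F) (K0 K : {subfield L}).

Record character := Character {
  char_val :>
    forall A : comAlgType F, {lrmorphism L -> A} -> torus K0 K A -> Gm A;
  charM : forall (A : comAlgType F) (phi : {lrmorphism L -> A}),
    {morph char_val phi : s t / (s * t)%g};
  char_nat : forall (A B : comAlgType F) (phi : {lrmorphism L -> A})
      (psi : {lrmorphism L -> B}) (f : {lrmorphism A -> B}),
    (forall x, f (phi x) = psi x) ->
    forall t, Gm_map (lrmorphism_monoid_morphism f) (char_val phi t)
              = char_val psi (torus_fmap f t)
}.

Lemma char_ext (chi chi' : character) :
  (forall (A : comAlgType F) (phi : {lrmorphism L -> A}) t, chi A phi t = chi' A phi t) ->
  chi = chi'.
Proof.
case: chi chi' => [c cM cN] [d dM dN] /= e.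
have {e} e : c = d.
  by apply: functional_extensionality_dep => A; apply/funext=> phi; apply/funext.
by case: d / e dM dN => dM dN; congr Character; apply: Prop_irrelevance.
Qed.

Definition char_zero : character.
Proof.
exists (fun A _ _ => 1%g) => [A phi s t|A B phi psi f _ t].
  by rewrite mulg1.
by rewrite Gm_map1.
Defined.

Definition char_opp (chi : character) : character.
Proof.
exists (fun A phi t => (chi A phi t)^-1)%g => [A phi s t|A B phi psi f e t].
  by rewrite charM invgM Gm_commute.
by rewrite Gm_mapV (char_nat chi e).
Defined.

Definition char_add (chi chi' : character) : character.
Proof.
exists (fun A phi t => chi A phi t * chi' A phi t)%g
    => [A phi s t|A B phi psi f e t].
  by rewrite !charM; apply: Gm_val_inj; rewrite !Gm_valM mulrACA.
by rewrite Gm_mapM (char_nat chi e) (char_nat chi' e).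
Defined.

Fact char_addA : associative char_add.
Proof. by move=> a b c; apply: char_ext => A phi t /=; rewrite mulgA. Qed.
Fact char_addC : commutative char_add.
Proof. by move=> a b; apply: char_ext => A phi t /=; rewrite Gm_commute. Qed.
Fact char_add0 : left_id char_zero char_add.
Proof. by move=> a; apply: char_ext => A phi t /=; rewrite mul1g. Qed.
Fact char_addN : left_inverse char_zero char_opp char_add.
Proof. by move=> a; apply: char_ext => A phi t /=; rewrite mulVg. Qed.

Definition char_group : abgroup :=
  AbGroup char_addA char_addC char_add0 char_addN.

End Characters.

(* MathComp groups act on the right, and composition in 'Gal(E / F) is such   *)
(* that (g * h) x = h (g x): a left module over the Galois group of the usual *)
(* convention is a right module in this one.                                  *)
Record gmodule (G : finGroupType) := GModule {
  gmodule_group :> abgroup;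
  gact : gmodule_group -> G -> gmodule_group;
  gact1 : forall x, gact x 1%g = x;
  gactM : forall x g h, gact x (g * h)%g = gact (gact x g) h;
  gactD : forall g, {morph gact^~ g : x y / (x + y)%ab}
}.

(* In degree 1 Tate cohomology of a finite group is by definition ordinary    *)
(* cohomology: crossed homomorphisms modulo the principal ones.               *)
Section Cohomology.
Variables (G : finGroupType) (M : gmodule G).
Local Open Scope ab_scope.

Lemma gact0 g : gact (0 : M) g = 0.
Proof. by apply: (abDI (z := gact 0 g)); rewrite -gactD !ab0D. Qed.

Lemma gactN g : {morph (@gact G M)^~ g : x / - x}.
Proof. by move=> x; apply: (abDI (z := gact x g)); rewrite -gactD !abND gact0. Qed.

Record cocycle := Cocycle {
  cocycle_fun :> G -> M;
  cocycleM : forall g h, cocycle_fun (g * h)%g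
                         = gact (cocycle_fun g) h + cocycle_fun h
}.

Definition cocycle0 : cocycle.
Proof. by exists (fun=> 0) => g h; rewrite gact0 ab0D. Defined.

Definition cocycleN (c : cocycle) : cocycle.
Proof. by exists (fun g => - c g) => g h; rewrite cocycleM abND2 gactN. Defined.

Definition cocycleD (c d : cocycle) : cocycle.
Proof.
by exists (fun g => c g + d g) => g h; rewrite !cocycleM gactD abACA.
Defined.

Definition cohomologous (c d : cocycle) : Prop :=
  exists x : M, forall g, c g - d g = gact x g - x.

Lemma cohom_eqfun (c d : cocycle) : c =1 d -> cohomologous c d.
Proof. by move=> e; exists 0 => g; rewrite e gact0 !abDN. Qed.

Lemma cohom_refl c : cohomologous c c.
Proof. exact: cohom_eqfun. Qed.

Lemma cohom_sym c d : cohomologous c d -> cohomologous d c.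
Proof.
move=> [x hx]; exists (- x) => g.
by rewrite gactN -abND2 -hx abND2 abNN abDC.
Qed.

Lemma cohomN c d :
  cohomologous c d -> cohomologous (cocycleN c) (cocycleN d).
Proof.
move=> [x hx]; exists (- x) => g /=.
by rewrite gactN -!abND2 -hx.
Qed.

Lemma cohomD c c' d d' : cohomologous c c' -> cohomologous d d' ->
  cohomologous (cocycleD c d) (cocycleD c' d').
Proof.
move=> [x hx] [y hy]; exists (x + y) => g /=.
by rewrite gactD !abND2 abACA hx hy abACA.
Qed.

Lemma cohom_trans c d e :
  cohomologous c d -> cohomologous d e -> cohomologous c e.
Proof.
move=> [x hx] [y hy]; exists (x + y) => g.
rewrite gactD abND2 abACA -hx -hy abDA; congr (_ + _).
by rewrite abNK.
Qed.

Definition H1_sort : Type :=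
  {h : cocycle -> Prop | exists c, h = cohomologous c}.

Definition H1_class (c : cocycle) : H1_sort :=
  exist _ (cohomologous c) (ex_intro _ c erefl).

Definition H1_repr (h : H1_sort) : cocycle := sval (cid (svalP h)).

Lemma H1_val_inj (h k : H1_sort) : sval h = sval k -> h = k.
Proof. by apply: eq_sig_hprop => x p q; apply: Prop_irrelevance. Qed.

Lemma H1_eqP c d : H1_class c = H1_class d <-> cohomologous c d.
Proof.
split=> [/(congr1 sval) /= ->|cd]; first exact: cohom_refl.
apply: H1_val_inj => /=; apply/funext=> e; apply/propext; split=> [ce|de].
  exact: cohom_trans (cohom_sym cd) ce.
exact: cohom_trans cd de.
Qed.

Lemma H1_reprK : cancel H1_repr H1_class.
Proof.
by move=> h; apply: H1_val_inj; rewrite /= -(svalP (cid (svalP h))).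
Qed.

Lemma H1_repr_class c : cohomologous (H1_repr (H1_class c)) c.
Proof. by apply/H1_eqP; rewrite H1_reprK. Qed.

Definition H1_zero := H1_class cocycle0.
Definition H1_opp h := H1_class (cocycleN (H1_repr h)).
Definition H1_add h k := H1_class (cocycleD (H1_repr h) (H1_repr k)).

Lemma H1_addE c d : H1_add (H1_class c) (H1_class d) = H1_class (cocycleD c d).
Proof. by apply/H1_eqP/cohomD; apply: H1_repr_class. Qed.
Lemma H1_oppE c : H1_opp (H1_class c) = H1_class (cocycleN c).
Proof. exact/H1_eqP/cohomN/H1_repr_class. Qed.

Fact H1_addA : associative H1_add.
Proof.
move=> h k l; rewrite -(H1_reprK h) -(H1_reprK k) -(H1_reprK l) !H1_addE.
by apply/H1_eqP/cohom_eqfun=> g /=; rewrite abDA.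
Qed.
Fact H1_addC : commutative H1_add.
Proof.
move=> h k; rewrite -(H1_reprK h) -(H1_reprK k) !H1_addE.
by apply/H1_eqP/cohom_eqfun=> g /=; rewrite abDC.
Qed.
Fact H1_add0 : left_id H1_zero H1_add.
Proof.
move=> h; rewrite -(H1_reprK h) H1_addE.
by apply/H1_eqP/cohom_eqfun=> g /=; rewrite ab0D.
Qed.
Fact H1_addN : left_inverse H1_zero H1_opp H1_add.
Proof.
move=> h; rewrite -(H1_reprK h) H1_oppE H1_addE.
by apply/H1_eqP/cohom_eqfun=> g /=; rewrite abND.
Qed.

Definition H1 : abgroup := AbGroup H1_addA H1_addC H1_add0 H1_addN.

End Cohomology.

(* The character lattice as a module over the Galois group of L: sigma maps   *)
(* chi to sigma o chi o sigma^-1, which on points in an L-algebra (A, phi)    *)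
(* is chi on the twisted L-algebra (A, phi o sigma).                          *)
Section CharacterModule.
Variables (F : fieldType) (L : splittingFieldType F) (K0 K : {subfield L}).

Definition char_act (chi : character K0 K) (s : gal_of {:L}) :
  character K0 K.
Proof.
exists (fun (A : comAlgType F) (phi : {lrmorphism L -> A}) t =>
          chi A (phi \o s) t) => [A phi t t'|A B phi psi f e t].
  by rewrite charM.
by apply: char_nat => x /=; exact: e.
Defined.

Lemma char_eq_phi (chi : character K0 K) (A : comAlgType F)
    (phi psi : {lrmorphism L -> A}) t :
  phi =1 psi -> chi A phi t = chi A psi t.
Proof.
move=> e; rewrite -[t in RHS](torus_fmap_id t).
rewrite -(char_nat chi (f := idfun) e).
by apply: Gm_val_inj.
Qed.

Fact char_act1 chi : char_act chi 1%g = chi.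
Proof.
by apply: char_ext => A phi t /=; apply: char_eq_phi => x /=; rewrite gal_id.
Qed.

Fact char_actM chi g h : char_act chi (g * h)%g = char_act (char_act chi g) h.
Proof.
apply: char_ext => A phi t /=; apply: char_eq_phi => x /=.
by rewrite galM ?memvf.
Qed.

Fact char_actD g : {morph char_act^~ g : x y / char_add x y}.
Proof. by move=> x y; apply: char_ext. Qed.

Definition character_module : gmodule (gal_of {:L}) :=
  @GModule _ (char_group K0 K) _ char_act1 char_actM char_actD.

End CharacterModule.

(* CM fields, as subfields of an ambient number field L.  Embeddings into the *)
(* complex numbers take values in the algebraic numbers algC.                 *)
Section CM.
Variable L : fieldExtType rat.
Implicit Types E K : {subfield L}.

Definition totally_real E : Prop :=
  forall (f : {rmorphism subvs_of E -> algC}) x, f x \is Num.real.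

Definition totally_imaginary E : Prop :=
  forall f : {rmorphism subvs_of E -> algC}, exists x, f x \isn't Num.real.

Definition CM_field K : Prop :=
  totally_imaginary K /\
  exists E : {subfield L},
    [/\ (E <= K)%VS, totally_real E & \dim_E K = 2].

Definition maximal_totally_real_subfield K0 K : Prop :=
  [/\ (K0 <= K)%VS, totally_real K0 &
      forall E : {subfield L}, (E <= K)%VS -> totally_real E -> (E <= K0)%VS].

End CM.

(* L is the Galois closure over Q of its subfield K. *)
Definition is_galois_closure (L : splittingFieldType rat)
    (K : {subfield L}) : Prop :=
  galois 1%AS {:L} /\
  forall E : {subfield L}, (K <= E)%VS -> galois 1%AS E -> E = {:L}%AS.

(* The double cosets A \ G / B.  With G a Galois group in the composition     *)
(* order of MathComp, inversion is an isomorphism onto the opposite group     *)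
(* preserving subgroups, so their number is that of the usual convention.     *)
Definition double_cosets (gT : finGroupType) (A G B : {set gT}) :
    {set {set gT}} :=
  [set (A :* x * B)%g | x in G].

(* Main.v *)
Require Import Defs.
From HB Require Import structures.
From mathcomp Require Import all_boot all_order all_fingroup all_algebra.
From mathcomp Require Import all_solvable all_field.
From mathcomp Require Import boolp ring zify.

(* Let S = Hom(K, L) and let iota be complex conjugation, central in the      *)
(* Galois group G.  Over L the torus is {(x, y) : y_s y_(iota s) = x}, so a   *)
(* character chi is determined by its degree w on z |-> (z^2; z, ..., z) and  *)
(* the odd function f on S giving its degrees on the cocharacters (y_s = z,   *)
(* y_(iota s) = 1/z); the only constraint is w = sum f mod 2 over a CM type   *)
(* A. If c = (w, f) is a 1-cocycle then w = 0, and comparing c(g iota) with   *)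
(* c(iota g) gives 2 f(g) = v - g v for v = f(iota), whose parity is constant *)
(* on S.  For v even c is a coboundary, so v mod 2 embeds H^1 in Z/2.  A      *)
(* cocycle with v odd exists iff every g changes the sign of an even number   *)
(* of elements of A.  The parity of this number is the sign of g on S, hence  *)
(* that of the number of cycles of g, i.e. of double cosets, since |S| is     *)
(* even.                                                                      *)

Set Implicit Arguments.
Unset Strict Implicit.
Unset Printing Implicit Defensive.

Import GRing.Theory Num.Theory.
Local Open Scope ring_scope.

(** The bound is proved for any module with the weight and coordinates described above. After
    inverting 2, a cocycle c is the coboundary of -c(iota)/2, so the only obstruction over the
    integers is the parity of c(iota), a single bit because G is transitive on S ([even_coboundary],
    [H1_parity_inj]). If this bit is 1, the congruence between the weight and the sum of coordinates
    forces every g to move an even number of elements of A out of A. Conversely, if all these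
    numbers are even, the coboundary of the vector with values -1/2 on A and 1/2 off A has integral
    coordinates and lifts to a cocycle with odd bit ([H1_trivial_sign_changes]). Counting double
    cosets instead is the work of [odd_perm_sign_changes] and [odd_double_cosets]. That characters
    have such coordinates ([char_decomp], [char_coord_inj], [char_weight_coord_char]) rests on the
    splitting of K (x) A into copies of A over L ([emb_ev_inj], [emb_ev_surj]), on the norm being a
    product of two conjugates ([emb_ev_norm]), and on natural endomorphisms of G_m being powers
    ([natural_Gm_power]). The central involution comes from [CM_conjugation]. *)

(** * Signs of permutations that commute with an involution *)

Section SignedPermutation.
Variables (T : finType) (j : T -> T) (A : {set T}).
Hypotheses (jK : involutive j) (jA : forall x, (j x \in A) = (x \notin A)).

(** The restrictions of [s] to [A] and to its complement are conjugate under [j], so their signs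
    cancel. *)
Lemma odd_perm_stable (s : {perm T}) :
  (forall x, s (j x) = j (s x)) -> (forall x, (s x \in A) = (x \in A)) ->
  odd_perm s = false.
Proof.
move=> sj sA; pose a := restr_perm A s; pose J := perm (inv_inj jK).
have sN : s \in ('N(A | 'P))%g.
  by rewrite !inE /=; apply/subsetP=> x xA; rewrite !inE /= /aperm sA.
have -> : s = (a * a ^ J)%g.
  have JV : (J^-1 = J)%g.
    apply/eqP; rewrite eq_invg_mul; apply/eqP/permP=> x.
    by rewrite !permE /= !permE jK.
  apply/permP=> x; rewrite /conjg JV !permM ![J _]permE.
  have aA y : y \in A -> a y = s y by apply: restr_permE.
  have aNA y : y \notin A -> a y = y by apply: out_perm; apply: restr_perm_on.
  have [xA|xA] := boolP (x \in A).
    by rewrite (aA x) // aNA ?jK // jA sA xA.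
  by rewrite (aNA x) // aA ?jA // sj jK.
by rewrite odd_permM odd_permJ addbb.
Qed.

(* Composing s with the transposition of x and j x removes the sign change at *)
(* x and reverses the parity of s.                                            *)
Lemma odd_perm_sign_changes (s : {perm T}) :
  (forall x, s (j x) = j (s x)) ->
  odd_perm s = odd #|[set x in A | s x \notin A]|.
Proof.
have [n] := ubnP #|[set x in A | s x \notin A]|; elim: n s => // n IH s le sj.
have [D0|[x]] := set_0Vmem [set x in A | s x \notin A].
  rewrite D0 cards0 odd_perm_stable // => x.
  have sA y : y \in A -> s y \in A.
    move=> yA; apply/negPn/negP=> sy.
    by have := in_set0 y; rewrite -D0 inE yA sy.
  apply/idP/idP=> [sx|/sA //]; apply/negPn/negP; rewrite -jA => /sA.
  by rewrite sj jA sx.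
rewrite inE => /andP[xA sx].
have xj : x != j x by apply/eqP=> e; have := jA x; rewrite -e xA.
pose t := (tperm x (j x) * s)%g.
have tj y : t (j y) = j (t y).
  rewrite !permM; case: (tpermP x (j x) y) => [->|->|/eqP yx /eqP yj].
  - by rewrite tpermR sj jK.
  - by rewrite jK tpermL sj.
  rewrite tpermD ?sj //; first by rewrite eq_sym (inv_eq jK).
  by rewrite (can_eq jK) eq_sym.
have tD : [set y in A | t y \notin A] = [set y in A | s y \notin A] :\ x.
  apply/setP=> y; rewrite !inE !permM.
  case: (tpermP x (j x) y) => [->|->|/eqP yx /eqP yj].
  - by rewrite eqxx sj jA sx andbF.
  - by rewrite jA xA andbF.
  by rewrite yx.
move: le; rewrite (cardsD1 x) inE xA sx -tD add1n ltnS oddS => le.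
by rewrite -IH // odd_mul_tperm xj; case: (odd_perm s).
Qed.

End SignedPermutation.

(** From each pair, keep the element of smaller rank; applied to embeddings, this gives a CM
    type. *)
Lemma involution_transversal (T : finType) (j : T -> T) :
  involutive j -> (forall x, j x != x) ->
  exists A : {set T}, forall x, (j x \in A) = (x \notin A).
Proof.
move=> jK jx; exists [set x | (enum_rank x < enum_rank (j x))%N] => x.
rewrite !inE jK -leqNgt ltn_neqAle (inj_eq val_inj) (inj_eq enum_rank_inj).
by rewrite jx.
Qed.

Lemma intr_Z2_eq0 (n : int) : (n%:~R == 0 :> 'Z_2) = (2 %| n)%Z.
Proof.
have natE (k : nat) : (k%:R == 0 :> 'Z_2) = (2 %| k)%N.
  by rewrite Zp_nat -val_eqE /= -/(dvdn 2 k).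
case: n => k; first by rewrite -pmulrn natE.
by rewrite NegzE mulrNz oppr_eq0 -pmulrn natE; lia.
Qed.

(** * Degree one cohomology of a module given by a weight and odd coordinates *)

Section CoordinateModule.
Variables (G : finGroupType) (M : gmodule G) (S : finType) (act : S -> G -> S).
Variables (iota : G) (A : {set S}) (s0 : S).
Variables (wt : M -> int) (co : M -> S -> int).

Hypothesis act1 : forall s, act s 1%g = s.
Hypothesis actM : forall s g h, act s (g * h)%g = act (act s g) h.
Hypothesis act_trans : forall s, exists g, s = act s0 g.
Hypothesis iotaC : forall g, (iota * g = g * iota)%g.
Hypothesis iota2 : (iota * iota = 1)%g.
Local Notation bar s := (act s iota).
Hypothesis barA : forall s, (bar s \in A) = (s \notin A).
Hypothesis wtD : forall x y, wt (abD x y) = wt x + wt y.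
Hypothesis coD : forall x y s, co (abD x y) s = co x s + co y s.
Hypothesis wt_act : forall (x : M) g, wt (Defs.gact x g) = wt x.
Hypothesis co_act : forall (x : M) g s,
  co (Defs.gact x g) s = co x (act s g^-1)%g.
Hypothesis co_bar : forall x s, co x (bar s) = - co x s.
Hypothesis wt_co : forall x, exists k, wt x = k *+ 2 + \sum_(s in A) co x s.
Hypothesis wt_co_inj : forall x y, wt x = wt y -> co x =1 co y -> x = y.
Hypothesis wt_co_surj : forall k f, (forall s, f (bar s) = - f s) ->
  exists x, wt x = k *+ 2 + \sum_(s in A) f s /\ co x =1 f.

Let iotaV : (iota^-1 = iota)%g.
Proof. by apply/eqP; rewrite eq_invg_mul iota2. Qed.
Let barK : involutive (fun s => bar s).
Proof. by move=> s; rewrite -actM iota2 act1. Qed.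
Let bar_act s g : bar (act s g) = act (bar s) g.
Proof. by rewrite -!actM iotaC. Qed.

Let wt0 : wt ab0 = 0.
Proof. by apply: (addrI (wt ab0)); rewrite -wtD ab0D addr0. Qed.
Let co0 s : co ab0 s = 0.
Proof. by apply: (addrI (co ab0 s)); rewrite -coD ab0D addr0. Qed.
Let wtN x : wt (abN x) = - wt x.
Proof. by apply: (addrI (wt x)); rewrite -wtD abDN wt0 subrr. Qed.
Let coN x s : co (abN x) s = - co x s.
Proof. by apply: (addrI (co x s)); rewrite -coD abDN co0 subrr. Qed.

(** The action preserves weights, so the weight of a cocycle is a homomorphism from a finite group
    to the integers. *)
Lemma cocycle_wt (c : cocycle M) g : wt (c g) = 0.
Proof.
have wtM h k : wt (c (h * k)%g) = wt (c h) + wt (c k).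
  by rewrite cocycleM wtD wt_act.
have wtX n : wt (c (g ^+ n)%g) = wt (c g) *+ n.
  elim: n => [|n IH]; last by rewrite expgS wtM IH mulrS.
  by apply: (addrI (wt (c 1%g))); rewrite -wtM mulg1 addr0.
have /eqP := wtX #[g]%g; rewrite expg_order -(expg0 g) wtX mulr0n eq_sym.
by rewrite mulrn_eq0 eqn0Ngt order_gt0 => /eqP.
Qed.

(* Since iota is central and acts by -1 on coordinates, a cocycle becomes the *)
(* coboundary of -c(iota)/2 after inverting 2.                                *)
Lemma cocycle_co (c : cocycle M) g s :
  co (c g) s *+ 2 = co (c iota) s - co (c iota) (act s g^-1)%g.
Proof.
have := congr1 (fun h => co (c h) s) (iotaC g).
rewrite !cocycleM !coD !co_act iotaV co_bar; lia.
Qed.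

Lemma parity_co (c : cocycle M) s t :
  (2 %| co (c iota) s)%Z = (2 %| co (c iota) t)%Z.
Proof.
have base u : (2 %| co (c iota) u)%Z = (2 %| co (c iota) s0)%Z.
  have [g ->] := act_trans u; have := cocycle_co c g^-1%g s0.
  rewrite invgK; lia.
by rewrite !base.
Qed.

Lemma even_coboundary (c : cocycle M) : (2 %| co (c iota) s0)%Z ->
  exists x, forall g, c g = abD (Defs.gact x g) (abN x).
Proof.
move=> ev0; have ev s : (2 %| co (c iota) s)%Z by rewrite (parity_co c s s0).
pose f s := - (co (c iota) s %/ 2)%Z.
have fE s : co (c iota) s = - (f s *+ 2).
  by have := ev s; rewrite /f; lia.
(* The constant 0 is an arbitrary choice: the weight of x cancels in its coboundary. *)
have [s|x [_ xf]] := @wt_co_surj 0 f.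
  by have := co_bar (c iota) s; rewrite !fE; lia.
exists x => g; apply: wt_co_inj => [|s].
  by rewrite cocycle_wt wtD wt_act wtN subrr.
have := cocycle_co c g s; rewrite coD coN co_act !xf !fE; lia.
Qed.

(** At [iota] the coboundary of x has coordinates -2 times those of x. *)
Lemma cohomologous_parity (c d : cocycle M) s : cohomologous c d ->
  (2 %| co (c iota) s - co (d iota) s)%Z.
Proof.
move=> [x /(_ iota) e]; rewrite -coN -coD e coD coN co_act iotaV co_bar; lia.
Qed.

(** Independent of the representative by [cohomologous_parity], and of [s0] by [parity_co]. *)
Definition H1_parity (h : H1 M) : 'Z_2 := (co (H1_repr h iota) s0)%:~R.

Lemma H1_parity_class (c : cocycle M) :
  H1_parity (H1_class c) = (co (c iota) s0)%:~R.
Proof.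
apply/eqP; rewrite -subr_eq0 -intrB intr_Z2_eq0.
exact/cohomologous_parity/H1_repr_class.
Qed.

Lemma H1_parityD : {morph H1_parity : x y / abD x y >-> x + y}.
Proof.
move=> h k; rewrite /= -{1}(H1_reprK h) -{1}(H1_reprK k) H1_addE.
by rewrite H1_parity_class /= coD intrD.
Qed.

Lemma H1_parity_inj : injective H1_parity.
Proof.
move=> h k /eqP; rewrite -subr_eq0 -intrB intr_Z2_eq0 => e.
rewrite -(H1_reprK h) -(H1_reprK k); apply/H1_eqP.
have [|x xE] := @even_coboundary (cocycleD (H1_repr h) (cocycleN (H1_repr k))).
  by rewrite /= coD coN.
by exists x.
Qed.

Definition sign_changes g := [set s in A | act s g \notin A].

(** Replacing [act s g] by its conjugate whenever it leaves [A] gives a permutation of [A]; each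
    replacement changes a sign, whence the doubled correction. *)
Lemma sum_act_sign_changes (v : S -> int) g : (forall s, v (bar s) = - v s) ->
  \sum_(s in A) v (act s g)
  = \sum_(s in A) v s + (\sum_(s in sign_changes g) v (act s g)) *+ 2.
Proof.
move=> vbar; pose w s := if act s g \in A then act s g else bar (act s g).
have wA s : w s \in A by rewrite /w; case: ifP => // /negbT; rewrite -barA.
have act_inj : injective (act^~ g).
  by move=> s t /(congr1 (act^~ g^-1%g)); rewrite -!actM mulgV !act1.
have w_inj : {in A &, injective w}.
  move=> s t sA tA; rewrite /w; case: ifP; case: ifP => _ _.
  - exact: act_inj.
  - by rewrite bar_act => /act_inj e; move: sA; rewrite e barA tA.
  - by rewrite bar_act => /act_inj e; move: tA; rewrite -e barA sA.
  by move=> /(inv_inj barK)/act_inj.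
have wAE : w @: A = A.
  apply/eqP; rewrite eqEcard card_in_imset // leqnn andbT.
  by apply/subsetP=> _ /imsetP[s _ ->].
rewrite -[in X in _ = X + _]wAE big_imset //= -sumrMnl.
have scE : sign_changes g =i (fun s => (s \in A) && (act s g \notin A)).
  by move=> s; rewrite inE.
rewrite [in X in _ = _ + X](eq_bigl _ _ scE).
rewrite big_mkcondr -big_split; apply: eq_bigr => s _ /=; rewrite /w.
by case: ifP => //=; rewrite ?addr0 // vbar; lia.
Qed.

Lemma H1_trivial_sign_changes :
  (forall h : H1 M, h = ab0) <-> (exists g, odd #|sign_changes g|).
Proof.
split=> [H0|[g g_odd] h].
  apply: contrapT => no_odd.
  have even_sc g : ~~ odd #|sign_changes g|.
    by apply/negP=> godd; apply: no_odd; exists g.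
  (* The coboundary of the half-integral odd vector equal to -1/2 on [A] and 1/2 off [A]. *)
  pose f g s : int := (s \in A)%:Z - (act s g^-1%g \in A)%:Z.
  have fbar g s : f g (bar s) = - f g s.
    by rewrite /f -bar_act !barA; case: (s \in A); case: (act s _ \in A).
  have fsum g : \sum_(s in A) f g s = #|sign_changes g^-1|%:Z.
    rewrite /f -sum1_card (big_morph Posz PoszD (erefl _)).
    have scE :
        sign_changes g^-1 =i (fun s => (s \in A) && (act s g^-1%g \notin A)).
      by move=> s; rewrite inE.
    rewrite (eq_bigl _ _ scE).
    by rewrite big_mkcondr; apply: eq_bigr => s ->; case: (act s _ \in A).
  have cP g : exists x, wt x = 0 /\ co x =1 f g.
    (* This constant cancels the sum of the coordinates, which is even by assumption, and makes the
       weight 0. *)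
    have [x [wx xf]] := wt_co_surj (- (#|sign_changes g^-1|./2)%:Z) (fbar g).
    exists x; split=> //; rewrite wx fsum.
    by have := even_sc g^-1%g; lia.
  pose c g := sval (cid (cP g)).
  have wc g : wt (c g) = 0 by rewrite /c; case: cid => x [].
  have cc g : co (c g) =1 f g by rewrite /c; case: cid => x [].
  have cM g h : c (g * h)%g = abD (Defs.gact (c g) h) (c h).
    apply: wt_co_inj => [|s]; first by rewrite wtD wt_act !wc.
    by rewrite coD co_act !cc /f invMg actM; ring.
  (* The class is not trivial: at [iota] and [s0] its coordinate is 1 or -1. *)
  have := congr1 H1_parity (H0 (H1_class (Cocycle cM))).
  rewrite /= /H1_zero !H1_parity_class /= co0 => /eqP.
  rewrite intr_Z2_eq0 cc /f iotaV barA; case: (s0 \in A); lia.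
apply: H1_parity_inj; rewrite /= /H1_zero H1_parity_class /= co0.
apply/eqP; rewrite intr_Z2_eq0; apply: contraT => v_odd.
set c := H1_repr h in v_odd.
have vodd s : ~~ (2 %| co (c iota) s)%Z by rewrite (parity_co c s s0).
(* Sum [cocycle_co] over [A]: only the sign changes of g survive, each counted twice. *)
have sumE : \sum_(s in A) co (c g^-1%g) s
    = - \sum_(s in sign_changes g) co (c iota) (act s g).
  suff: (\sum_(s in A) co (c g^-1%g) s) *+ 2
      = - (\sum_(s in sign_changes g) co (c iota) (act s g)) *+ 2.
    by move=> /eqP; rewrite eqr_pMn2r // => /eqP.
  rewrite -sumrMnl; under eq_bigr => s _ do rewrite cocycle_co invgK.
  rewrite sumrB sum_act_sign_changes; last exact: co_bar.
  by rewrite opprD addrA subrr add0r mulNrn.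
have par (D : {set S}) (v : S -> int) : (forall s, ~~ (2 %| v s)%Z) ->
    (2 %| \sum_(s in D) v s)%Z = ~~ odd #|D|.
  move=> vo; rewrite -sum1_card.
  apply: (big_rec2 (fun (x : int) (y : nat) => (2 %| x)%Z = ~~ odd y)) => //.
  by move=> s x y _; have := vo s; lia.
(* Weight 0 makes this sum even, although it consists of an odd number of odd terms. *)
have [k] := wt_co (c g^-1%g); rewrite cocycle_wt sumE => kE.
have := par (sign_changes g) (fun s => co (c iota) (act s g)) (fun s => vodd _).
by rewrite g_odd; lia.
Qed.

Lemma H1_of_coordinates :
  (exists f : H1 M -> 'Z_2,
     {morph f : x y / abD x y >-> x + y} /\ injective f) /\
  ((forall h : H1 M, h = ab0) <-> exists g, odd #|sign_changes g|).
Proof.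
split; last exact: H1_trivial_sign_changes.
by exists H1_parity; split; [exact: H1_parityD | exact: H1_parity_inj].
Qed.

End CoordinateModule.

(* Additive copy of G_m(R), so that integral powers are written z *~ n. *)
Definition GmZ (R : comNzRingType) := Gm R.

Section GmZ.
Variable R : comNzRingType.

HB.instance Definition _ := Choice.on (GmZ R).

Fact GmZ_addA : associative (fun u v : GmZ R => (u * v)%g : GmZ R).
Proof. by move=> u v w; rewrite mulgA. Qed.
Fact GmZ_addC : commutative (fun u v : GmZ R => (u * v)%g : GmZ R).
Proof. by move=> u v; rewrite Gm_commute. Qed.
Fact GmZ_add0 : left_id (1%g : GmZ R) (fun u v : GmZ R => (u * v)%g : GmZ R).
Proof. by move=> u; rewrite mul1g. Qed.
Fact GmZ_addN : left_inverse (1%g : GmZ R) (fun u : GmZ R => u^-1%g : GmZ R)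
  (fun u v : GmZ R => (u * v)%g : GmZ R).
Proof. by move=> u; rewrite mulVg. Qed.
HB.instance Definition _ :=
  GRing.isZmodule.Build (GmZ R) GmZ_addA GmZ_addC GmZ_add0 GmZ_addN.

Lemma GmZ_addE (u v : GmZ R) : u + v = (u * v)%g. Proof. by []. Qed.

End GmZ.

Section GmZMap.
Variables (F : fieldType) (A B : comAlgType F) (f : {lrmorphism A -> B}).

Definition GmZ_map (u : GmZ A) : GmZ B :=
  Gm_map (lrmorphism_monoid_morphism f) u.

Fact GmZ_map_zmod_morphism : zmod_morphism GmZ_map.
Proof. by move=> u v; rewrite [LHS]Gm_mapM Gm_mapV. Qed.
HB.instance Definition _ :=
  GRing.isZmodMorphism.Build _ _ GmZ_map GmZ_map_zmod_morphism.
End GmZMap.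

(** * The Laurent ring and natural endomorphisms of G_m *)

Section Laurent.
Variables (F : fieldType) (L : fieldExtType F).

Local Notation Q := {fraction {poly L}}.
Local Notation "x %:F" := (@tofrac {poly L} x).
Local Notation T := (('X : {poly L})%:F : Q).

Lemma fracX_neq0 n : T ^+ n != 0.
Proof. by rewrite expf_neq0 // tofrac_eq0 polyX_eq0. Qed.

(** L[X, 1/X] is cut out of L(X), from which it inherits its ring structure. It represents G_m on
    L-algebras, X being the universal point. *)
Definition laurent_pred : {pred Q} :=
  fun x => `[< exists p n, x * T ^+ n = (p : {poly L})%:F >].

Lemma laurentP x :
  reflect (exists p n, x * T ^+ n = (p : {poly L})%:F) (x \in laurent_pred).
Proof. exact: asboolP. Qed.

Fact laurent_subring_closed : subring_closed laurent_pred.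
Proof.
split=> [|x y /laurentP[p [n xE]] /laurentP[q [m yE]]
         |x y /laurentP[p [n xE]] /laurentP[q [m yE]]]; apply/laurentP.
- by exists 1, 0%N; rewrite mulr1 tofrac1.
- exists (p * 'X^m - q * 'X^n), (n + m)%N.
  by rewrite tofracB !tofracM -xE -yE !tofracXn exprD; ring.
- exists (p * q), (n + m)%N.
  by rewrite tofracM -xE -yE exprD mulrACA.
Qed.
HB.instance Definition _ :=
  GRing.isSubringClosed.Build Q laurent_pred laurent_subring_closed.

Record laurent := Laurent { lval : Q; _ : lval \in laurent_pred }.
HB.instance Definition _ := [isSub for lval].
HB.instance Definition _ := [Choice of laurent by <:].
HB.instance Definition _ := [SubChoice_isSubComNzRing of laurent by <:].

Fact laurentC_mem (a : L) : (a%:P)%:F \in laurent_pred.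
Proof. by apply/laurentP; exists a%:P, 0%N; rewrite mulr1. Qed.
Definition laurentC_val (a : L) : laurent := Laurent (laurentC_mem a).

Fact laurentC_zmod_morphism : zmod_morphism laurentC_val.
Proof. by move=> a b; apply: val_inj; rewrite /= polyCB tofracB. Qed.
Fact laurentC_monoid_morphism : GRing.monoid_morphism laurentC_val.
Proof.
by split=> [|a b]; apply: val_inj; rewrite /= ?tofrac1 // polyCM tofracM.
Qed.
HB.instance Definition _ :=
  GRing.isZmodMorphism.Build _ _ laurentC_val laurentC_zmod_morphism.
HB.instance Definition _ :=
  GRing.isMonoidMorphism.Build _ _ laurentC_val laurentC_monoid_morphism.

Definition laurent_scale (c : F) (x : laurent) : laurent :=
  laurentC_val c%:A * x.
Fact laurent_scaleA a b x :
  laurent_scale a (laurent_scale b x) = laurent_scale (a * b) x.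
Proof. by rewrite /laurent_scale mulrA -rmorphM -scalerAl mul1r scalerA. Qed.
Fact laurent_scale1 : left_id 1 laurent_scale.
Proof. by move=> x; rewrite /laurent_scale scale1r rmorph1 mul1r. Qed.
Fact laurent_scaleDr : right_distributive laurent_scale +%R.
Proof. by move=> a x y; rewrite /laurent_scale mulrDr. Qed.
Fact laurent_scaleDl x : {morph laurent_scale^~ x : a b / a + b}.
Proof. by move=> a b; rewrite /laurent_scale scalerDl rmorphD mulrDl. Qed.
HB.instance Definition _ := GRing.Zmodule_isLmodule.Build F laurent
  laurent_scaleA laurent_scale1 laurent_scaleDr laurent_scaleDl.
Fact laurent_scaleAl (a : F) (x y : laurent) : a *: (x * y) = a *: x * y.
Proof. by rewrite /GRing.scale /= /laurent_scale mulrA. Qed.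
HB.instance Definition _ := GRing.Lmodule_isLalgebra.Build F laurent
  laurent_scaleAl.
HB.instance Definition _ := GRing.Lalgebra_isComAlgebra.Build F laurent.

Lemma laurent_scaleE (c : F) (x : laurent) :
  c *: x = laurentC_val c%:A * x.
Proof. by []. Qed.

Fact laurentC_scalable : scalable laurentC_val.
Proof. by move=> c x; rewrite laurent_scaleE -rmorphM -scalerAl mul1r. Qed.
HB.instance Definition _ :=
  GRing.isScalable.Build F L laurent *:%R laurentC_val laurentC_scalable.
Definition laurentC : {lrmorphism L -> laurent} := laurentC_val.

Fact laurentX_mem : T \in laurent_pred.
Proof. by apply/laurentP; exists 'X, 0%N; rewrite mulr1. Qed.
Fact laurentXV_mem : T^-1 \in laurent_pred.
Proof.
by apply/laurentP; exists 1, 1%N; rewrite expr1 mulVf ?tofrac1 ?(fracX_neq0 1).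
Qed.
Fact laurentX_proof :
  (Laurent laurentX_mem, Laurent laurentXV_mem).1
  * (Laurent laurentX_mem, Laurent laurentXV_mem).2 == 1.
Proof.
by apply/eqP/val_inj; rewrite /= mulfV ?(fracX_neq0 1).
Qed.
Definition laurentX : Gm laurent := MkGm laurentX_proof.

Section Eval.
Variables (A : comAlgType F) (phi : {lrmorphism L -> A}) (z : Gm A).

Let hev (p : {poly L}) : A := (map_poly phi p).[Gm_val z].

Let zV : Gm_val z * Gm_val z^-1%g = 1.
Proof. exact: Gm_valVr. Qed.

Let hevM p q : hev (p * q) = hev p * hev q.
Proof. by rewrite /hev rmorphM hornerM. Qed.
Let hevB p q : hev (p - q) = hev p - hev q.
Proof. by rewrite /hev rmorphB hornerD hornerN. Qed.
Let hevXn n : hev 'X^n = Gm_val z ^+ n.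
Proof. by rewrite /hev map_polyXn hornerXn. Qed.
Let hevC c : hev c%:P = phi c.
Proof. by rewrite /hev map_polyC hornerC. Qed.

Fact laurent_numP (x : laurent) :
  exists pn : {poly L} * nat, lval x * T ^+ pn.2 = (pn.1)%:F.
Proof. by case: x => x /= /laurentP[p [n xE]]; exists (p, n). Qed.

Definition laurent_ev_val (x : laurent) : A :=
  let pn := sval (cid (laurent_numP x)) in hev pn.1 * Gm_val z^-1%g ^+ pn.2.

(** The chosen fraction p / X^n does not matter, since X is sent to the unit z. *)
Lemma laurent_evE x p n : lval x * T ^+ n = p%:F ->
  laurent_ev_val x = hev p * Gm_val z^-1%g ^+ n.
Proof.
move=> e; rewrite /laurent_ev_val; case: cid => -[q m] /= e'.
have {e e'} : p * 'X^m = q * 'X^n.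
  by apply/eqP; rewrite -tofrac_eq !tofracM -e -e' !tofracXn mulrAC.
move=> /(congr1 hev); rewrite !hevM !hevXn => e.
have zn k : Gm_val z ^+ k * Gm_val z^-1%g ^+ k = 1.
  by rewrite -exprMn zV expr1n.
rewrite -[hev q]mulr1 -(zn n) mulrA -e -[RHS]mulr1 -(zn m) -!mulrA.
by congr (_ * _); rewrite mulrC -!mulrA; congr (_ * _); rewrite mulrC.
Qed.

Fact laurent_ev_zmod_morphism : zmod_morphism laurent_ev_val.
Proof.
move=> x y; have [[p n] /= xE] := laurent_numP x.
have [[q m] /= yE] := laurent_numP y.
rewrite (laurent_evE (p := p * 'X^m - q * 'X^n) (n := n + m)) /=; last first.
  rewrite tofracB !tofracM -xE -yE !tofracXn exprD; ring.
rewrite (laurent_evE xE) (laurent_evE yE) hevB !hevM !hevXn exprD mulrBl.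
have zn k : Gm_val z ^+ k * Gm_val z^-1%g ^+ k = 1.
  by rewrite -exprMn zV expr1n.
by rewrite mulrACA zn mulr1 [in X in _ - X](mulrC (_ ^+ n)) mulrACA zn mulr1.
Qed.
Fact laurent_ev_monoid_morphism : GRing.monoid_morphism laurent_ev_val.
Proof.
split=> [|x y].
  rewrite (laurent_evE (p := 1) (n := 0)) ?mulr1 ?tofrac1 //.
  by rewrite -polyC1 hevC rmorph1.
have [[p n] /= xE] := laurent_numP x.
have [[q m] /= yE] := laurent_numP y.
rewrite (laurent_evE (p := p * q) (n := n + m)) /=; last first.
  by rewrite tofracM -xE -yE exprD mulrACA.
by rewrite (laurent_evE xE) (laurent_evE yE) hevM exprD mulrACA.
Qed.

Lemma laurent_evC c : laurent_ev_val (laurentC c) = phi c.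
Proof. by rewrite (laurent_evE (p := c%:P) (n := 0)) ?mulr1 // hevC. Qed.

Fact laurent_ev_scalable : scalable laurent_ev_val.
Proof.
move=> c x; rewrite laurent_scaleE laurent_ev_monoid_morphism.2 laurent_evC.
by rewrite linearZ rmorph1 -scalerAl mul1r.
Qed.

HB.instance Definition _ :=
  GRing.isZmodMorphism.Build _ _ laurent_ev_val laurent_ev_zmod_morphism.
HB.instance Definition _ :=
  GRing.isMonoidMorphism.Build _ _ laurent_ev_val laurent_ev_monoid_morphism.
HB.instance Definition _ :=
  GRing.isScalable.Build F laurent A *:%R laurent_ev_val laurent_ev_scalable.
Definition laurent_ev : {lrmorphism laurent -> A} := laurent_ev_val.

Lemma laurent_evX : GmZ_map laurent_ev laurentX = z.
Proof.
apply: Gm_val_inj; rewrite /GmZ_map Gm_mapE.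
rewrite [LHS](laurent_evE (p := 'X) (n := 0)) ?mulr1 //.
by rewrite -['X]expr1 hevXn.
Qed.

End Eval.

(** If p / X^n has inverse q / X^m, then p divides a power of X, hence is a constant times some
    X^k. *)
Lemma laurent_unit (u : Gm laurent) : exists a n,
  Gm_val u = laurentC a * Gm_val ((laurentX : GmZ laurent) *~ n : GmZ laurent).
Proof.
case: u => -[x y] /= xy; rewrite {1}/Gm_val /=.
have [[p n] /= xE] := laurent_numP x; have [[q m] /= yE] := laurent_numP y.
have pq : p * q = 'X^(n + m).
  apply/eqP; rewrite -tofrac_eq tofracM -xE -yE tofracXn exprD mulrACA.
  have /= -> := congr1 lval (eqP xy).
  by rewrite mul1r.
have Xp k : Gm_val ((laurentX : GmZ laurent) *+ k : GmZ laurent)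
    = Gm_val laurentX ^+ k.
  elim: k => [|k IH]; first by rewrite mulr0n expr0.
  by rewrite mulrS exprS -IH -Gm_valM.
have /dvdp_exp_XsubCP[k kle] : p %| ('X - 0%:P) ^+ (n + m).
  by rewrite subr0 -pq dvdp_mulr.
rewrite subr0 => /eqpP[[c d] /= /andP[c0 d0] pE].
have {pE} pE : p = (d / c) *: 'X^k.
  by rewrite mulrC -scalerA -pE scalerA mulVf // scale1r.
exists (d / c), (k%:Z - n%:Z).
set w := Gm_val _.
have wE : w * Gm_val laurentX ^+ n = Gm_val laurentX ^+ k.
  rewrite -!Xp -Gm_valM -GmZ_addE; congr Gm_val.
  by rewrite mulrzBr /= subrK.
apply: val_inj => /=; apply: (mulIf (fracX_neq0 n)).
rewrite xE pE -mul_polyC tofracM -mulrA; congr (_ * _).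
have valX i : val (Gm_val laurentX ^+ i) = T ^+ i by rewrite rmorphXn.
by have /(congr1 val) := wE; rewrite rmorphM /= !valX tofracXn.
Qed.

(* A unit of the Laurent ring is a monomial, and the value of a family at the *)
(* universal point X determines it. *)
Lemma natural_Gm_power
    (c : forall A : comAlgType F, {lrmorphism L -> A} -> GmZ A -> GmZ A) :
  (forall (A B : comAlgType F) (phi : {lrmorphism L -> A})
      (psi : {lrmorphism L -> B}) (f : {lrmorphism A -> B}),
    (forall x, f (phi x) = psi x) ->
    forall z, GmZ_map f (c A phi z) = c B psi (GmZ_map f z)) ->
  (forall (A : comAlgType F) (phi : {lrmorphism L -> A}), c A phi 0 = 0) ->
  exists n : int, forall (A : comAlgType F) (phi : {lrmorphism L -> A}) z,
    c A phi z = z *~ n.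
Proof.
move=> c_nat c0.
have [a [n cX]] := laurent_unit (c laurent laurentC laurentX); exists n.
have cE (A : comAlgType F) (phi : {lrmorphism L -> A}) (z : GmZ A) :
    Gm_val (c A phi z) = phi a * Gm_val (z *~ n).
  rewrite -{1}(laurent_evX phi z).
  rewrite -(c_nat _ _ laurentC phi (laurent_ev phi z) (laurent_evC phi z)).
  rewrite Gm_mapE cX rmorphM; congr (_ * _); first exact: laurent_evC.
  rewrite -[in RHS](laurent_evX phi z) -raddfMz //.
(* The neutral point, written 0 in [GmZ], is sent to itself, which removes the constant factor. *)
have a1 : a = 1.
  by have := cE L idfun 0; rewrite c0 mul0rz /= Gm_val1 mulr1.
by move=> A phi z; apply: Gm_val_inj; rewrite cE a1 rmorph1 mul1r.
Qed.

Lemma laurentX_pow_inj :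
  injective (fun n : int => (laurentX : GmZ laurent) *~ n).
Proof.
have pow0 k : (laurentX : GmZ laurent) *+ k = 0 -> k = 0%N.
  move=> /(congr1 (fun u => val (Gm_val u))).
  have -> : val (Gm_val ((laurentX : GmZ laurent) *+ k : GmZ laurent)) = T ^+ k.
    elim: k => [|k IH]; first by rewrite mulr0n expr0.
    by rewrite mulrS exprS -IH.
  move=> /eqP; rewrite /= -tofracXn -tofrac1 tofrac_eq.
  move=> /eqP/(congr1 (@size _ : {poly L} -> _)).
  by rewrite size_polyXn size_poly1 => -[].
move=> n m /eqP; rewrite -subr_eq0 -mulrzBr => /eqP e.
apply/eqP; rewrite -subr_eq0; case: (n - m) e => k.
  by move=> /pow0 ->.
by rewrite NegzE mulrNz => /eqP; rewrite oppr_eq0 => /eqP/pow0.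
Qed.

End Laurent.

(** * Evaluation of E (x) A at a morphism from E to A *)

Section TensorEval.
Variables (F : fieldType) (E : fieldExtType F) (A : comAlgType F).
Variable h : {lrmorphism E -> A}.

Definition tensor_ev (u : tensor E A) : A :=
  \sum_(i < \dim {:E}) h (vbasis {:E})`_i * u 0 i.

Fact tensor_ev_zmod_morphism : zmod_morphism tensor_ev.
Proof.
move=> u v; rewrite /tensor_ev -sumrB; apply: eq_bigr => i _.
by rewrite !mxE mulrBr.
Qed.
HB.instance Definition _ :=
  GRing.isZmodMorphism.Build _ _ tensor_ev tensor_ev_zmod_morphism.

Lemma tensor_ev_pure e a : tensor_ev (pure e a) = h e * a.
Proof.
rewrite [in RHS](coord_vbasis (memvf e)) linear_sum mulr_suml.
by apply: eq_bigr => i _; rewrite mxE linearZ /= -scalerAr scalerAl.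
Qed.

Fact tensor_ev_monoid_morphism : GRing.monoid_morphism tensor_ev.
Proof.
split=> [|u v]; first by rewrite -pure11 tensor_ev_pure rmorph1 mul1r.
move: u; apply: pure_ind => [|u u' hu hu'|e a].
- by rewrite mul0r raddf0 mul0r.
- by rewrite mulrDl !raddfD /= hu hu' mulrDl.
move: v; apply: pure_ind => [|v v' hv hv'|e' a'].
- by rewrite mulr0 raddf0 mulr0.
- by rewrite mulrDr !raddfD /= hv hv' mulrDr.
by rewrite pureM !tensor_ev_pure rmorphM mulrACA.
Qed.
HB.instance Definition _ :=
  GRing.isMonoidMorphism.Build _ _ tensor_ev tensor_ev_monoid_morphism.

End TensorEval.

Lemma tensor_ev_map (F : fieldType) (E : fieldExtType F) (A B : comAlgType F)
    (h : {lrmorphism E -> A}) (k : {lrmorphism E -> B})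
    (f : {lrmorphism A -> B}) :
  (forall x, f (h x) = k x) ->
  forall u, f (tensor_ev h u) = tensor_ev k (tensor_map f u).
Proof.
move=> fh u; rewrite /tensor_ev rmorph_sum; apply: eq_bigr => i _ /=.
by rewrite rmorphM mxE; congr (_ * _); exact: fh.
Qed.

Lemma eq_tensor_ev (F : fieldType) (E : fieldExtType F) (A : comAlgType F)
  (h k : {lrmorphism E -> A}) : h =1 k -> tensor_ev h =1 tensor_ev k.
Proof. by move=> hk u; apply: eq_bigr => i _; rewrite hk. Qed.

Lemma gal_all (F : fieldType) (L : splittingFieldType F) :
  'Gal({:L} / 1)%g = [set: gal_of {:L}].
Proof.
apply/eqP; rewrite eqEsubset subsetT; apply/subsetP=> g _.
by rewrite gal_kHom ?sub1v // k1HomE ahomWin.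
Qed.

(** * Embeddings of K into L and the splitting of K (x) A *)

Section Embeddings.
Variables (F : fieldType) (L : splittingFieldType F) (K : {subfield L}).
Local Notation Gam := (gal_of {:L}).
Local Notation N := 'Gal({:L} / K)%g.

(** The restriction of g to K is encoded by the coset N g: as (n * g) x = g (n x), the elements of N
    g agree on K. Right multiplication of cosets is then composition of embeddings with
    automorphisms of L. *)
Definition embeddings := {C : {set Gam} | C \in rcosets N [set: Gam]}.
HB.instance Definition _ := Finite.on embeddings.

Fact emb_of_proof (g : Gam) : (N :* g)%g \in rcosets N [set: Gam].
Proof. by apply/rcosetsP; exists g; rewrite ?inE. Qed.
Definition emb_of g : embeddings :=
  exist (fun C => C \in rcosets N [set: Gam]) _ (emb_of_proof g).
Definition emb_repr (C : embeddings) : Gam := repr (val C).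

Lemma emb_reprK : cancel emb_repr emb_of.
Proof.
case=> C CN; apply: val_inj => /=; rewrite /emb_repr /=.
by case/rcosetsP: CN => g _ ->; exact: rcoset_repr.
Qed.

Lemma emb_ofP g h : reflect (emb_of g = emb_of h) (g * h^-1 \in N)%g.
Proof.
rewrite -mem_rcoset; apply: (iffP idP) => [/rcoset_eqP e|/(congr1 val)/= e].
  exact/val_inj.
by rewrite -e rcoset_refl.
Qed.

Definition emb_act (C : embeddings) (g : Gam) : embeddings :=
  emb_of (emb_repr C * g)%g.

Lemma emb_actE x g : emb_act (emb_of x) g = emb_of (x * g)%g.
Proof.
apply/emb_ofP; rewrite invMg mulgA mulgK.
by apply/emb_ofP; rewrite emb_reprK.
Qed.

Lemma emb_act1 C : emb_act C 1%g = C.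
Proof. by rewrite /emb_act mulg1 emb_reprK. Qed.

Lemma emb_actM C g h : emb_act C (g * h)%g = emb_act (emb_act C g) h.
Proof. by rewrite -(emb_reprK C) !emb_actE mulgA. Qed.

Lemma emb_actK g : cancel (emb_act^~ g) (emb_act^~ g^-1)%g.
Proof. by move=> C; rewrite -emb_actM mulgV emb_act1. Qed.
Lemma emb_actKV g : cancel (emb_act^~ g^-1)%g (emb_act^~ g)%g.
Proof. by move=> C; rewrite -emb_actM mulVg emb_act1. Qed.

Lemma eq_emb g h : emb_of g = emb_of h -> {in K, g =1 h}.
Proof.
move=> /emb_ofP ghN x xK.
rewrite -[g](mulgKV h) galM ?memvf //; congr (_ _).
by rewrite (fixed_gal _ ghN) ?subvf.
Qed.

Hypothesis galL : galois 1 {:L}.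

Let galK : galois K {:L}.
Proof. by apply: galoisS galL; rewrite sub1v subvf. Qed.

Lemma card_embeddings : #|{: embeddings}| = \dim {:subvs_of K}.
Proof.
rewrite card_sig; transitivity #|[set: Gam] : N|%g; first exact: eq_card.
have NG : N \subset [set: Gam] by rewrite subsetT.
rewrite dimvf -[RHS]/(\dim K); apply/eqP.
have cG : #|[set: Gam]| = \dim {:L}.
  by rewrite -gal_all -galois_dim // dimv1 divn1.
rewrite -(eqn_pmul2l (cardG_gt0 N)) (Lagrange NG) cG -galois_dim //.
by rewrite -dim_sup_field ?subvf.
Qed.

(* Composing with the trace from L to K reduces this to the independence of   *)
(* the automorphisms of L.                                                    *)
Lemma emb_independent (c : embeddings -> L) :
  (forall y, y \in K -> \sum_C c C * emb_repr C y = 0) -> forall C, c C = 0.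
Proof.
move=> c0 C; rewrite -(emb_reprK C).
apply: (gal_independent (P := predT) (c_ := fun g => c (emb_of g))) => // a _.
rewrite (partition_big emb_of predT) //=.
rewrite -[RHS](c0 _ (mem_galTrace galK (memvf a))).
apply: eq_bigr => D _; rewrite raddf_sum mulr_sumr.
rewrite (reindex_inj (mulIg (emb_repr D))) /=; apply: eq_big => [g|g].
  rewrite -{2}(emb_reprK D); apply/eqP/idP=> [/emb_ofP|gN].
    by rewrite mulgK.
  by apply/emb_ofP; rewrite mulgK.
by move=> /eqP ->; rewrite galM ?memvf.
Qed.

Definition emb_map (A : comAlgType F) (phi : {lrmorphism L -> A}) (g : Gam) :
  {lrmorphism subvs_of K -> A} := phi \o (g \o vsval).

Local Notation n := (\dim {:subvs_of K}).
Local Notation b := (vbasis {:subvs_of K}).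

Definition emb_mx : 'M[L]_(#|{: embeddings}|, n) :=
  \matrix_(i, j) emb_repr (enum_val i) (vsval b`_j).

Lemma emb_mx_free : row_free emb_mx.
Proof.
apply: inj_row_free => v /rowP v0; apply/rowP=> i; rewrite mxE.
rewrite -(enum_valK i).
apply: (emb_independent (c := fun C => v 0 (enum_rank C))) => y yK.
rewrite (reindex_onto enum_val enum_rank) => [|? _]; last exact: enum_rankK.
rewrite (eq_bigl predT) => [|j]; last by rewrite /= enum_valK eqxx.
have -> : y = \sum_(j < n) coord b j (Subvs yK) *: vsval b`_j.
  rewrite -[LHS]/(vsval (Subvs yK)) {1}(coord_vbasis (memvf (Subvs yK))).
  by rewrite linear_sum; apply: eq_bigr => j _; rewrite linearZ.
under eq_bigr => j _ do rewrite linear_sum mulr_sumr.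
rewrite exchange_big big1 //= => k _.
have := congr1 (fun x => coord b k (Subvs yK) *: x) (v0 k).
rewrite !mxE scaler0 => {2}<-; rewrite scaler_sumr; apply: eq_bigr => j _.
by rewrite mxE linearZ /= enum_valK scalerAr.
Qed.

Lemma emb_mx_inv : exists W : 'M[L]_(n, #|{: embeddings}|),
  emb_mx *m W = 1%:M /\ W *m emb_mx = 1%:M.
Proof.
exists (pinvmx emb_mx); have VW := mulmxVp emb_mx_free; split=> //.
(* Both matrices are generalised so that [card_embeddings] can make them square; a right inverse is
   then a left inverse. *)
move: (emb_mx) (pinvmx _) VW; rewrite card_embeddings => V W.
exact: mulmx1C.
Qed.

Variables (A : comAlgType F) (phi : {lrmorphism L -> A}).

Local Notation ev g := (tensor_ev (emb_map phi g)).

Lemma eq_emb_ev g h : emb_of g = emb_of h -> ev g =1 ev h.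
Proof.
by move=> gh; apply: eq_tensor_ev => x /=; rewrite (eq_emb gh) ?subvsP.
Qed.

(** The evaluations are the coordinates of u transformed by the invertible matrix [emb_mx]. *)
Lemma emb_ev_inj (u v : tensor (subvs_of K) A) :
  (forall g, ev g u = ev g v) -> u = v.
Proof.
move=> uv; have [W [_ WV]] := emb_mx_inv.
have evE w : map_mx phi emb_mx *m w^T = \col_i ev (emb_repr (enum_val i)) w.
  by apply/colP=> i; rewrite !mxE; apply: eq_bigr => j _; rewrite !mxE.
apply: trmx_inj; rewrite -[u^T]mul1mx -[v^T]mul1mx -(map_mx1 phi) -WV.
rewrite map_mxM -!mulmxA !evE; congr (_ *m _).
by apply/colP=> i; rewrite !mxE uv.
Qed.

Lemma emb_ev_surj (Y : embeddings -> A) :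
  exists u, forall g, ev g u = Y (emb_of g).
Proof.
have [W [VW _]] := emb_mx_inv.
pose y := \col_(i < #|{: embeddings}|) Y (enum_val i).
pose u := map_mx phi W *m y.
have uE : map_mx phi emb_mx *m u = y.
  by rewrite mulmxA -map_mxM VW map_mx1 mul1mx.
exists u^T => g; rewrite -(eq_emb_ev (emb_reprK (emb_of g))).
have /matrixP/(_ (enum_rank (emb_of g)) 0) := uE.
rewrite [RHS]mxE enum_rankK => <-; rewrite mxE.
by apply: eq_bigr => j _; rewrite !mxE enum_rankK.
Qed.

End Embeddings.

(** * The norm from K to K0 as a product of two conjugates *)

Section RelativeNorm.
Variables (F : fieldType) (L : splittingFieldType F) (K0 K : {subfield L}).
Local Notation Gam := (gal_of {:L}).
Local Notation m := (\dim (vspaceOver K0 K)).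
Local Notation b := (vbasis (vspaceOver K0 K)).

Hypothesis deg2 : m = 2%N.
Variable iota : Gam.
Hypothesis iotaK0 : iota \in 'Gal({:L} / K0)%g.
Hypothesis iotaK : exists2 y, y \in K & iota y != y.

Variable g : Gam.

(** The two embeddings of K that agree with g on K0. The index is a natural number, which avoids
    casts between ['I_m] and ['I_2]. *)
Definition conj_emb (j : nat) : Gam := if j == 0%N then g else (iota * g)%g.

Lemma conj_embK0 x j : x \in K0 -> conj_emb j x = g x.
Proof.
rewrite /conj_emb; case: eqP => // _ xK0.
by rewrite galM ?memvf // (fixed_gal _ iotaK0) ?subvf.
Qed.

Definition conj_mx : 'M[L]_m := \matrix_(i, j) conj_emb j b`_i.

Lemma sum_deg2 (V : nmodType) (f : nat -> V) : \sum_(j < m) f j = f 0%N + f 1%N.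
Proof. by rewrite deg2 big_ord_recr big_ord1. Qed.

Lemma mult_mxE (y : subvs_of K) (i : 'I_m) :
  vsval y * (b`_i : L) = \sum_(k < m) vsval (mult_mx i k y) * (b`_k : L).
Proof.
have := coord_vbasis (mult_mx_mem y i); rewrite /mult_mx => {1}->.
by apply: eq_bigr => k _; rewrite fieldOver_scaleE.
Qed.

(** A relation between the two embeddings on a K0-basis extends to K; evaluating it at 1 and at some
    y moved by [iota] kills both coefficients. *)
Lemma conj_mx_unit : \det conj_mx != 0.
Proof.
have [y yK iy] := iotaK; rewrite -det_tr; apply/det0P => -[v v0 vM].
pose c (j : nat) := if insub j is Some k then v 0 k else 0.
have cE (k : 'I_m) : c k = v 0 k by rewrite /c valK.
have cb (x : L) : x \in K -> c 0%N * g x + c 1%N * g (iota x) = 0.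
  move=> xK; have xKO : (x : fieldOver K0) \in vspaceOver K0 K.
    by have := memv_mul (mem1v K0) xK; rewrite mul1r mem_vspaceOver.
  have xE j : conj_emb j x
      = \sum_(k < m) g (vsval (coord b k x)) * conj_emb j (b`_k : L).
    have xb := coord_vbasis xKO; rewrite [in LHS]xb -[RHS]/(_ : L) linear_sum.
    apply: eq_bigr => k _; rewrite fieldOver_scaleE rmorphM /=.
    by rewrite conj_embK0 ?subvsP.
  have <- : \sum_(j < m) c j * conj_emb j x = c 0%N * g x + c 1%N * g (iota x).
    rewrite (sum_deg2 (fun j => c j * conj_emb j x)) /conj_emb /=.
    by rewrite galM ?memvf.
  under eq_bigr => j _ do rewrite xE mulr_sumr.
  rewrite exchange_big big1 //= => k _.
  have /rowP/(_ k) := vM; rewrite !mxE.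
  move=> /(congr1 ( *%R (g (vsval (coord b k x))))).
  rewrite mulr0 mulr_sumr => vk; rewrite -[RHS]vk; apply: eq_bigr => j _.
  by rewrite !mxE cE mulrCA.
have c01 : c 0%N = - c 1%N.
  by have /eqP := cb 1 (mem1v K); rewrite !rmorph1 !mulr1 addr_eq0 => /eqP.
have c1 : c 1%N = 0.
  have /eqP := cb y yK; rewrite c01 mulNr addrC -mulrBr -raddfB mulf_eq0.
  by rewrite fmorph_eq0 subr_eq0 (negPf iy) orbF => /eqP.
case/negP: v0; apply/eqP/rowP=> k; rewrite mxE -cE.
have : (k < 2)%N by rewrite -deg2.
by case: (k : nat) => [|[|]] //; rewrite c01 c1 oppr0.
Qed.

Variables (A : comAlgType F) (phi : {lrmorphism L -> A}).

(* The matrix of conjugates of a K0-basis of K diagonalises multiplication,   *)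
(* so that its determinant becomes the product of the two conjugates.         *)
Lemma emb_ev_norm_mx (u : tensor (subvs_of K) A) :
  map_mx (tensor_ev (emb_map K0 phi g))
      (\matrix_(i, j) base_change (mult_mx (K0 := K0) i j) u)
    *m map_mx phi conj_mx
  = map_mx phi conj_mx *m
      diag_mx (\row_(j < m) tensor_ev (emb_map K phi (conj_emb j)) u).
Proof.
have z0 i j :
    base_change (@mult_mx _ _ K0 K i j) (0 : tensor (subvs_of K) A) = 0.
  by rewrite -(pure0l _ 0) (base_change_pure (mult_mx_linear _ _)) pure0r.
apply/matrixP=> i j; rewrite mul_mx_diag !mxE.
move: u; apply: pure_ind => [|u v hu hv|e a].
- rewrite raddf0 mulr0 big1 // => k _.
  by rewrite !mxE z0 raddf0 mul0r.
- rewrite raddfD mulrDr -hu -hv -big_split; apply: eq_bigr => k _ /=.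
  by rewrite !mxE base_changeD raddfD mulrDl.
rewrite tensor_ev_pure /=.
transitivity (phi (conj_emb j (vsval e * (b`_i : L))) * a); last first.
  by rewrite mulrA !rmorphM /= [X in X * a]mulrC.
rewrite mult_mxE !rmorph_sum mulr_suml; apply: eq_bigr => k _; rewrite !mxE /=.
rewrite (base_change_pure (mult_mx_linear _ _)) tensor_ev_pure /= !rmorphM.
by rewrite /= (conj_embK0 _ (subvsP _)) mulrAC.
Qed.

Lemma emb_ev_norm (u : tensor (subvs_of K) A) :
  tensor_ev (emb_map K0 phi g) (tensor_norm K0 u) =
  tensor_ev (emb_map K phi g) u * tensor_ev (emb_map K phi (iota * g)%g) u.
Proof.
rewrite /tensor_norm -det_map_mx.
have := congr1 determinant (emb_ev_norm_mx u).
rewrite !det_mulmx mulrC det_diag !det_map_mx => e.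
(* The determinant of [conj_mx] is nonzero in the field L, so its image in A can be cancelled. *)
have := congr1 ( *%R (phi (\det conj_mx)^-1)) e.
rewrite !mulrA -!rmorphM mulVf ?conj_mx_unit // rmorph1 !mul1r => ->.
have -> : tensor_ev (emb_map K phi g) u
    * tensor_ev (emb_map K phi (iota * g)%g) u
  = \prod_(j < m) tensor_ev (emb_map K phi (conj_emb j)) u.
  by rewrite deg2 big_ord_recr big_ord1.
by apply: eq_bigr => j _; rewrite mxE.
Qed.

End RelativeNorm.

(** * Double cosets as orbits on the embeddings *)

Lemma card_imset_eq_kernel (T U V : finType) (f : T -> U) (h : T -> V) :
  (forall x y, f x = f y <-> h x = h y) -> #|f @: T| = #|h @: T|.
Proof.
move=> fh; have [T0|[x0 _]] := set_0Vmem [set: T].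
  rewrite !eq_card0 // => y; apply/negbTE/imsetP=> -[x _ _];
    by have := in_set0 x; rewrite -T0 inE.
pose k y := h (odflt x0 [pick x | f x == y]).
have kf x : k (f x) = h x.
  by rewrite /k; case: pickP => [z /eqP /fh //|/(_ x)]; rewrite eqxx.
have <- : k @: (f @: T) = h @: T.
  by rewrite -imset_comp; apply: eq_imset => x; apply: kf.
apply/esym/card_in_imset => _ _ /imsetP[x _ ->] /imsetP[y _ ->].
by rewrite !kf => /fh.
Qed.

Section DoubleCosets.
Variables (gT : finGroupType) (N : {group gT}) (g : gT).
Local Open Scope group_scope.

Lemma double_coset_absorb h x n : h \in <[g]> -> n \in N ->
  <[g]> :* (h * x * n) * N = <[g]> :* x * N.
Proof.
by move=> hg nN; rewrite !rcosetM rcoset_id // -[_ * N]mulgA lcoset_id.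
Qed.

Lemma mem_double_coset x y : y \in <[g]> :* x * N ->
  exists i, exists2 n, n \in N & y = g ^+ i * x * n.
Proof.
move=> /mulsgP[hx n /rcosetP[h /cycleP[i ->] ->] nN ->].
by exists i, n.
Qed.

End DoubleCosets.

Section EmbeddingOrbits.
Variables (F : fieldType) (L : splittingFieldType F) (K : {subfield L}).
Local Notation Gam := (gal_of {:L}).
Local Notation N := 'Gal({:L} / K)%g.
Variable g : Gam.

Definition emb_perm : {perm (embeddings K)} :=
  perm (can_inj (@emb_actK _ _ K g)).

Lemma emb_permX i C : (emb_perm ^+ i)%g C = emb_act C (g ^+ i)%g.
Proof.
elim: i C => [|i IH] C; first by rewrite perm1 emb_act1.
by rewrite !expgSr permM IH permE emb_actM.
Qed.

(** Orbits of right multiplication by g on the cosets N x correspond under inversion to the double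
    cosets of x^-1; [D] is this correspondence. *)
Lemma card_double_cosets_porbits :
  #|double_cosets <[g]>%g [set: Gam] N| = #|porbits emb_perm|.
Proof.
pose D (C : embeddings K) : {set Gam} := (<[g]> :* (emb_repr C)^-1 * N)%g.
have emb_reprE x : exists2 n, n \in N & emb_repr (emb_of K x) = (n * x)%g.
  have /emb_ofP := emb_reprK (emb_of K x) => ?.
  by exists (emb_repr (emb_of K x) * x^-1)%g => //; rewrite mulgKV.
have -> : double_cosets <[g]>%g [set: Gam] N = D @: [set: embeddings K].
  apply/setP=> X; apply/imsetP/imsetP=> -[x _ ->]; last first.
    by exists (emb_repr x)^-1%g; rewrite ?inE.
  exists (emb_of K x^-1%g); rewrite ?inE // /D.
  have [n nN ->] := emb_reprE x^-1%g.
  rewrite invMg invgK -[LHS](double_coset_absorb _ (group1 _) (groupVr nN)).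
  by rewrite mul1g.
have DE C C' : D C = D C' <-> porbit emb_perm C = porbit emb_perm C'.
  split=> [DCC'|/eqP].
    have : (emb_repr C')^-1%g \in D C.
      by rewrite DCC' -[X in X \in _]mulg1 mem_mulg ?group1 // rcoset_refl.
    move=> /mem_double_coset[i [n nN /(congr1 invg)]].
    rewrite invgK !invMg invgK => E.
    have -> : C = emb_act C' (g ^+ i)%g.
      rewrite -[C]emb_reprK -[C']emb_reprK emb_actE E; apply/emb_ofP.
      by rewrite mulgA mulgKV invMg invgK mulKVg.
    by rewrite -emb_permX porbit_perm.
  rewrite eq_porbit_mem => /porbitP[i ->]; rewrite emb_permX /D /emb_act.
  have [n nN ->] := emb_reprE (emb_repr C' * g ^+ i)%g.
  rewrite !invMg double_coset_absorb ?groupV //.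
  by rewrite mem_cycle.
rewrite /porbits -(card_imset_eq_kernel DE).
by apply: eq_card => X; apply/imsetP/imsetP=> -[C _ ->]; exists C; rewrite ?inE.
Qed.

(** The sign is the parity of |S| plus the number of cycles, and |S| is even because [A] and its
    image under [j] partition S. *)
Lemma odd_double_cosets (j : embeddings K -> embeddings K)
    (A : {set embeddings K}) :
  involutive j -> (forall C, (j C \in A) = (C \notin A)) ->
  odd #|double_cosets <[g]>%g [set: Gam] N| = odd_perm emb_perm.
Proof.
move=> jK jA; rewrite /odd_perm card_double_cosets_porbits.
suff -> : odd #|{: embeddings K}| = false by [].
rewrite -cardsT -(setUCr A) cardsU setICr cards0 subn0.
have -> : ~: A = j @: A.
  apply/setP=> C; rewrite inE -{2}[C]jK mem_imset ?jA //; exact: inv_inj.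
by rewrite card_imset ?addnn ?odd_double //; exact: inv_inj.
Qed.

End EmbeddingOrbits.

(** * The torus over L, its cocharacters and its characters *)

Section TorusCoordinates.
Variables (F : fieldType) (L : splittingFieldType F) (K0 K : {subfield L}).
Local Notation Gam := (gal_of {:L}).
Local Notation S := (embeddings K).

Hypothesis galL : galois 1 {:L}.
Hypothesis deg2 : \dim (vspaceOver K0 K) = 2%N.
Variable iota : Gam.
Hypothesis iotaK0 : iota \in 'Gal({:L} / K0)%g.
Hypothesis iotaK : exists2 y, y \in K & iota y != y.
Hypothesis iotaC : forall g : Gam, (iota * g = g * iota)%g.
Hypothesis iota2 : (iota * iota = 1)%g.

Definition bar (C : S) : S := emb_act C iota.

Lemma barK : involutive bar.
Proof. by move=> C; rewrite /bar -emb_actM iota2 emb_act1. Qed.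

Lemma bar_act C g : bar (emb_act C g) = emb_act (bar C) g.
Proof. by rewrite /bar -!emb_actM iotaC. Qed.

Lemma bar_emb_of g : bar (emb_of K g) = emb_of K (iota * g)%g.
Proof. by rewrite /bar emb_actE iotaC. Qed.

Lemma bar_neq C : bar C != C.
Proof.
have [y yK] := iotaK; apply: contra => /eqP.
rewrite -{1 2}(emb_reprK C) bar_emb_of => /eq_emb/(_ _ yK).
by rewrite galM ?memvf // => /fmorph_inj ->.
Qed.

Section Points.
Variables (A : comAlgType F) (phi : {lrmorphism L -> A}).

Definition torus_x (t : torus K0 K A) : GmZ A := (val t).1.
Definition torus_y (C : S) (t : torus K0 K A) : GmZ A :=
  Gm_map (tensor_ev_monoid_morphism (emb_map K phi (emb_repr C))) (val t).2.

Lemma torus_xM s t : torus_x (s * t)%g = torus_x s + torus_x t.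
Proof. by []. Qed.
Lemma torus_x1 : torus_x 1%g = 0.
Proof. by []. Qed.
Lemma torus_yM C s t : torus_y C (s * t)%g = torus_y C s + torus_y C t.
Proof. exact: Gm_mapM. Qed.
Lemma torus_y1 C : torus_y C 1%g = 0.
Proof. exact: Gm_map1. Qed.

Lemma torus_yE (g : Gam) t :
  Gm_val (torus_y (emb_of K g) t)
  = tensor_ev (emb_map K phi g) (Gm_val (val t).2).
Proof. by rewrite Gm_mapE; apply: eq_emb_ev; rewrite emb_reprK. Qed.

(** The equation in K0 (x) A can be tested at every embedding of K0, where [emb_ev_norm] computes
    the norm. *)
Lemma mem_torus_ker (p : Gm A * Gm (tensor (subvs_of K) A)) :
  (forall g : Gam, tensor_ev (emb_map K phi g) (Gm_val p.2)
    * tensor_ev (emb_map K phi (iota * g)%g) (Gm_val p.2) = Gm_val p.1) <->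
  p \in torus_ker K0 (A := A).
Proof.
have kerE : (p \in torus_ker K0 (A := A)) <->
    tensor_norm K0 (Gm_val p.2) = pure 1 (Gm_val p.1).
  split=> [/torus_kerP|] e.
    have := congr1 (fun u =>
      Gm_map (pure1_monoid_morphism (subvs_of K0) A) p.1 * u)%g e.
    by rewrite /torus_map mulgA mulgV mul1g mulg1 => /(congr1 (@Gm_val _)).
  apply/torus_kerP; rewrite /torus_map; apply: (canLR (mulKg _)).
  by rewrite mulg1; apply: Gm_val_inj; rewrite !Gm_mapE.
rewrite kerE; split=> [h | e g].
  apply: (emb_ev_inj galL (phi := phi)) => g.
  rewrite (emb_ev_norm deg2 iotaK0 iotaK) h tensor_ev_pure.
  by rewrite rmorph1 mul1r.
by rewrite -(emb_ev_norm deg2 iotaK0 iotaK) e tensor_ev_pure rmorph1 mul1r.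
Qed.

Lemma torus_y_bar C t : torus_y C t + torus_y (bar C) t = torus_x t.
Proof.
have /mem_torus_ker tP := valP t; rewrite -(emb_reprK C) bar_emb_of.
by apply: Gm_val_inj; rewrite -(tP (emb_repr C)) -!torus_yE.
Qed.

Lemma torus_ext s t :
  torus_x s = torus_x t -> (forall C, torus_y C s = torus_y C t) -> s = t.
Proof.
move=> xE yE; apply: val_inj.
rewrite [LHS]surjective_pairing [RHS]surjective_pairing.
congr (_, _); first exact: xE.
apply: Gm_val_inj; apply: (emb_ev_inj galL (phi := phi)) => g.
by rewrite -!torus_yE yE.
Qed.

(** With [torus_y_bar] and [torus_ext], this identifies the torus over L with the families
    satisfying y_C y_(bar C) = x, written additively. *)
Lemma torus_exists (x : GmZ A) (Y : S -> GmZ A) :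
  (forall C, Y C + Y (bar C) = x) ->
  exists t, torus_x t = x /\ forall C, torus_y C t = Y C.
Proof.
move=> Yx; have [u uE] := emb_ev_surj galL phi (fun C => Gm_val (Y C)).
have [u' u'E] := emb_ev_surj galL phi (fun C => Gm_val (- Y C)).
have uu' : (u, u').1 * (u, u').2 == 1.
  apply/eqP/(emb_ev_inj galL (phi := phi)) => g.
  by rewrite rmorphM rmorph1 /= uE u'E -Gm_valM -GmZ_addE subrr.
have tP : (x, MkGm uu') \in torus_ker K0 (A := A).
  apply/mem_torus_ker => g.
  by rewrite /= !uE -bar_emb_of -Gm_valM -(Yx (emb_of K g)).
exists (Torus tP); split=> // C; apply: Gm_val_inj.
by rewrite -{1}(emb_reprK C) torus_yE /= [LHS]uE emb_reprK.
Qed.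

End Points.

Lemma torus_y_map (A B : comAlgType F) (phi : {lrmorphism L -> A})
    (psi : {lrmorphism L -> B}) (f : {lrmorphism A -> B}) :
  (forall x, f (phi x) = psi x) ->
  forall C t, torus_y psi C (torus_fmap f t) = GmZ_map f (torus_y phi C t).
Proof.
move=> fphi C t; apply: Gm_val_inj; rewrite [RHS]Gm_mapE !Gm_mapE /=.
rewrite (tensor_ev_map (k := emb_map K psi (emb_repr C))) // => x.
exact: fphi.
Qed.

Lemma torus_x_map (A B : comAlgType F) (f : {lrmorphism A -> B}) t :
  torus_x (torus_fmap f t) = GmZ_map f (torus_x t).
Proof. exact: Gm_val_inj. Qed.

Lemma torus_y_twist (A : comAlgType F) (phi : {lrmorphism L -> A})
    (g : Gam) C t :
  torus_y (phi \o g) C t = torus_y phi (emb_act C g) t.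
Proof.
rewrite -{2}(emb_reprK C) emb_actE; apply: Gm_val_inj; rewrite torus_yE Gm_mapE.
by apply: eq_tensor_ev => x /=; rewrite galM ?memvf.
Qed.

Section Cocharacters.

(* cochar k f below is the cocharacter z |-> (z^k; (z^(f C))_C). *)
Definition is_cochar (k : int) (f : S -> int) := forall C, f C + f (bar C) = k.

(* Opaque on purpose: unfolding cochar makes conversion diverge. *)
Lemma cochar_sig (A : comAlgType F) (phi : {lrmorphism L -> A}) k f
    (z : GmZ A) :
  {t : torus K0 K A | is_cochar k f ->
    torus_x t = z *~ k /\ forall C, torus_y phi C t = z *~ f C}.
Proof.
apply: cid; have [kf|nkf] := pselect (is_cochar k f); last by exists 1%g.
have [C|t tP] := @torus_exists A phi (z *~ k) (fun C => z *~ f C); last first.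
  by exists t.
by rewrite -mulrzDr kf.
Qed.

Definition cochar (A : comAlgType F) (phi : {lrmorphism L -> A}) k f
    (z : GmZ A) :=
  sval (cochar_sig phi k f z).

Variables (k : int) (f : S -> int).
Hypothesis kf : is_cochar k f.

Lemma cochar_x (A : comAlgType F) (phi : {lrmorphism L -> A}) z :
  torus_x (cochar phi k f z) = z *~ k.
Proof. by rewrite /cochar; case: cochar_sig => t /= /(_ kf)[]. Qed.

Lemma cochar_y (A : comAlgType F) (phi : {lrmorphism L -> A}) z C :
  torus_y phi C (cochar phi k f z) = z *~ f C.
Proof. by rewrite /cochar; case: cochar_sig => t /= /(_ kf)[_ ->]. Qed.

Lemma cochar0 (A : comAlgType F) (phi : {lrmorphism L -> A}) :
  cochar phi k f 0 = 1%g.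
Proof.
apply: (torus_ext (phi := phi)) => [|C]; first by rewrite cochar_x mul0rz.
by rewrite cochar_y mul0rz torus_y1.
Qed.

Lemma cochar_map (A B : comAlgType F) (phi : {lrmorphism L -> A})
    (psi : {lrmorphism L -> B}) (h : {lrmorphism A -> B}) z :
  (forall x, h (phi x) = psi x) ->
  torus_fmap h (cochar phi k f z) = cochar psi k f (GmZ_map h z).
Proof.
move=> hphi; apply: (torus_ext (phi := psi)) => [|C].
  by rewrite torus_x_map !cochar_x raddfMz.
by rewrite (torus_y_map hphi) !cochar_y raddfMz.
Qed.

End Cocharacters.

Section Degree.
Variable chi : character K0 K.

Definition charZ (A : comAlgType F) (phi : {lrmorphism L -> A}) t : GmZ A :=
  chi A phi t.

Lemma charZM (A : comAlgType F) (phi : {lrmorphism L -> A}) s t :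
  charZ phi (s * t)%g = charZ phi s + charZ phi t.
Proof. by exact: Defs.charM. Qed.

Lemma charZ1 (A : comAlgType F) (phi : {lrmorphism L -> A}) : charZ phi 1%g = 0.
Proof.
by apply: (addrI (charZ phi 1%g)); rewrite -charZM mulg1 addr0.
Qed.

(** Composed with a cocharacter, [chi] becomes a natural endomorphism of G_m, hence a power map. The
    degree defaults to 0 when k and f define no cocharacter. *)
Lemma deg_sig k f : {n : int | is_cochar k f ->
  forall (A : comAlgType F) (phi : {lrmorphism L -> A}) z,
    charZ phi (cochar phi k f z) = z *~ n}.
Proof.
apply: cid.
have [kf|nkf] := pselect (is_cochar k f); last by exists 0.
have [|A phi|n nP] := @natural_Gm_power F L
    (fun A phi z => charZ phi (cochar phi k f z)).
- move=> A B phi psi h hphi z; rewrite -(cochar_map kf _ hphi).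
  exact: char_nat.
- by rewrite cochar0 // charZ1.
by exists n.
Qed.

Definition deg k f : int := sval (deg_sig k f).

Lemma degP k f : is_cochar k f ->
  forall (A : comAlgType F) (phi : {lrmorphism L -> A}) z,
    charZ phi (cochar phi k f z) = z *~ deg k f.
Proof. by rewrite /deg; case: deg_sig. Qed.

Lemma deg_unique k f n : is_cochar k f ->
  (forall (A : comAlgType F) (phi : {lrmorphism L -> A}) z,
    charZ phi (cochar phi k f z) = z *~ n) -> deg k f = n.
Proof.
move=> kf nP; apply: (@laurentX_pow_inj F L) => /=.
by rewrite -(degP kf (laurentC L)) nP.
Qed.

End Degree.

(** As a function of [D], the exponents of the cocharacter y_C = z, y_(bar C) = 1/z, x = 1. *)
Definition coroot (C D : S) : int := (D == C)%:Z - (D == bar C)%:Z.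

Lemma coroot_sym C D : coroot C D = coroot D C.
Proof. by rewrite /coroot -[in LHS](inv_eq barK) !(eq_sym C) (eq_sym D). Qed.

Lemma coroot_cochar C : is_cochar 0 (coroot C).
Proof.
move=> D; rewrite /coroot (inv_eq barK) (can_eq barK).
by rewrite addrA subrK subrr.
Qed.

Definition wt_cochar : is_cochar 2 (fun=> 1) := fun=> erefl.

Definition char_coord (chi : character K0 K) C : int := deg chi 0 (coroot C).
Definition char_weight (chi : character K0 K) : int := deg chi 2 (fun=> 1).

Lemma cochar_bar (A : comAlgType F) (phi : {lrmorphism L -> A}) C (z : GmZ A) :
  cochar phi 0 (coroot (bar C)) z = cochar phi 0 (coroot C) (- z).
Proof.
have cr := coroot_cochar; apply: (torus_ext (phi := phi)) => [|D].
  by rewrite [LHS](cochar_x (cr _)) [RHS](cochar_x (cr _)).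
rewrite [LHS](cochar_y (cr _)) [RHS](cochar_y (cr _)).
by rewrite mulNrz -mulrNz /coroot barK opprB.
Qed.

Lemma char_coord_bar chi C : char_coord chi (bar C) = - char_coord chi C.
Proof.
apply: deg_unique => [|A phi z]; first exact: coroot_cochar.
by rewrite cochar_bar (degP chi (coroot_cochar C)) mulNrz -mulrNz.
Qed.

Lemma char_coordD chi chi' C :
  char_coord (char_add chi chi') C = char_coord chi C + char_coord chi' C.
Proof.
apply: deg_unique => [|A phi z]; first exact: coroot_cochar.
by rewrite mulrzDr -!(degP _ (coroot_cochar C) phi).
Qed.

Lemma char_weightD chi chi' :
  char_weight (char_add chi chi') = char_weight chi + char_weight chi'.
Proof.
apply: deg_unique => [|A phi z]; first exact: wt_cochar.
by rewrite mulrzDr -!(degP _ wt_cochar phi).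
Qed.

(** By [torus_y_twist], the coordinate at D on the algebra twisted by g is the original one at D g,
    which accounts for the inverse. *)
Lemma cochar_twist (A : comAlgType F) (phi : {lrmorphism L -> A}) C (g : Gam)
    (z : GmZ A) :
  cochar phi 0 (coroot C) z
  = @cochar A (phi \o g) 0 (coroot (emb_act C g^-1)%g) z.
Proof.
have cr := coroot_cochar; apply: (@torus_ext A (phi \o g)) => [|D].
  by rewrite [LHS](cochar_x (cr _)) [RHS](cochar_x (cr _)).
rewrite [RHS](cochar_y (cr _)) torus_y_twist [LHS](cochar_y (cr _)).
by rewrite /coroot bar_act -!(can2_eq (emb_actK g) (emb_actKV g)).
Qed.

Lemma cochar_wt_twist (A : comAlgType F) (phi : {lrmorphism L -> A})
    (g : Gam) (z : GmZ A) :
  cochar phi 2 (fun=> 1) z = @cochar A (phi \o g) 2 (fun=> 1) z.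
Proof.
apply: (@torus_ext A (phi \o g)) => [|D].
  by rewrite !(cochar_x wt_cochar).
by rewrite torus_y_twist !(cochar_y wt_cochar).
Qed.

Lemma char_coord_act chi g C :
  char_coord (char_act chi g) C = char_coord chi (emb_act C g^-1)%g.
Proof.
apply: deg_unique => [|A phi z]; first exact: coroot_cochar.
rewrite (cochar_twist phi C g).
exact: (@degP chi _ _ (coroot_cochar _) A (phi \o g)).
Qed.

Lemma char_weight_act chi g : char_weight (char_act chi g) = char_weight chi.
Proof.
apply: deg_unique => [|A phi z]; first exact: wt_cochar.
rewrite (cochar_wt_twist phi g).
exact: (@degP chi _ _ wt_cochar A (phi \o g)).
Qed.

(** * Characters recovered and constructed from a weight and coordinates *)

Section CMType.
Variable Phi : {set S}.
Hypothesis PhiP : forall C, (bar C \in Phi) = (C \notin Phi).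

Definition cmtype_cochar_fun C : int := (C \notin Phi)%:Z.
Lemma cmtype_cochar : is_cochar 1 cmtype_cochar_fun.
Proof. by move=> C; rewrite /cmtype_cochar_fun PhiP; case: (C \in Phi). Qed.

Lemma sum_coroot (V : zmodType) (f : S -> V) D :
  \sum_(C in Phi) f C *~ coroot C D = if D \in Phi then f D else - f (bar D).
Proof.
have single E :
    \sum_(C in Phi) f C *~ (E == C)%:Z = if E \in Phi then f E else 0.
  case: ifP => EPhi.
    rewrite (bigD1 E) //= eqxx big1 ?addr0 // => C /andP[_ /negPf CE].
    by rewrite eq_sym CE.
  rewrite big1 // => C CPhi; case: eqP => [EC|] //.
  by rewrite EC CPhi in EPhi.
under eq_bigr => C _ do rewrite /coroot mulrzBr -(inv_eq barK).
rewrite sumrB !single PhiP; case: (D \in Phi) => /=.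
  by rewrite subr0.
by rewrite sub0r.
Qed.

(* t is the product of mu(x) and of the coroots evaluated at y_C, C in Phi,   *)
(* where mu(z) has y_C = 1 for C in Phi and y_C = z otherwise.                *)
Lemma char_decomp chi (A : comAlgType F) (phi : {lrmorphism L -> A}) t :
  charZ chi phi t = torus_x t *~ deg chi 1 cmtype_cochar_fun
    + \sum_(C in Phi) torus_y phi C t *~ char_coord chi C.
Proof.
pose s C := cochar phi 0 (coroot C) (torus_y phi C t).
have {1}-> : t = (cochar phi 1 cmtype_cochar_fun (torus_x t)
    * \prod_(C in Phi) s C)%g.
  have mu := cmtype_cochar; have cr := coroot_cochar.
  apply: (torus_ext (phi := phi)) => [|D].
    rewrite torus_xM (cochar_x mu) (big_morph _ (@torus_xM A) (@torus_x1 A)).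
    by rewrite big1 ?addr0 // => C _; rewrite /s (cochar_x (cr _)).
  rewrite torus_yM (cochar_y mu).
  rewrite (big_morph _ (@torus_yM A phi D) (@torus_y1 A phi D)).
  under eq_bigr => C _ do rewrite (cochar_y (cr _)).
  rewrite sum_coroot /cmtype_cochar_fun; case: (D \in Phi).
    by rewrite add0r.
  by rewrite -(torus_y_bar phi D) addrK.
rewrite charZM (degP chi cmtype_cochar).
rewrite (big_morph _ (@charZM chi A phi) (@charZ1 chi A phi)); congr (_ + _).
by apply: eq_bigr => C _; rewrite /s (degP chi (coroot_cochar C)).
Qed.

(** This is [char_decomp] on z |-> (z^2; z, ..., z), the source of the congruence modulo 2. *)
Lemma char_weightE chi : char_weight chi =
  deg chi 1 cmtype_cochar_fun *+ 2 + \sum_(C in Phi) char_coord chi C.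
Proof.
apply: deg_unique => [|A phi z]; first exact: wt_cochar.
rewrite char_decomp (cochar_x wt_cochar) [RHS]mulrzDr mulrz_sumr.
congr (_ + _).
  by rewrite -mulrzA mulr_natl.
by apply: eq_bigr => C _; rewrite (cochar_y wt_cochar).
Qed.

(** [char_weightE] gives back the degree on mu after division by 2, and [char_decomp] then the whole
    character. *)
Lemma char_coord_inj chi chi' : char_weight chi = char_weight chi' ->
  char_coord chi =1 char_coord chi' -> chi = chi'.
Proof.
move=> we ce; apply: char_ext => A phi t.
suff: charZ chi phi t = charZ chi' phi t by []; rewrite !char_decomp.
have -> : deg chi 1 cmtype_cochar_fun = deg chi' 1 cmtype_cochar_fun.
  move: we; rewrite !char_weightE (eq_bigr _ (fun C _ => ce C)) => /addIr.
  by move=> /eqP; rewrite eqr_pMn2r // => /eqP.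
by congr (_ + _); apply: eq_bigr => C _; rewrite ce.
Qed.

Section CharOfCoord.
Variables (n : int) (f : S -> int).

(** The formula of [char_decomp] with prescribed degrees: n on mu and f on the coroots of [Phi]. *)
Definition coord_char_val (A : comAlgType F) (phi : {lrmorphism L -> A})
    (t : torus K0 K A) : GmZ A :=
  torus_x t *~ n + \sum_(C in Phi) torus_y phi C t *~ f C.

Lemma coord_char_valM (A : comAlgType F) (phi : {lrmorphism L -> A}) s t :
  coord_char_val phi (s * t)%g = coord_char_val phi s + coord_char_val phi t.
Proof.
rewrite /coord_char_val torus_xM mulrzDl addrACA -big_split /=.
by congr (_ + _); apply: eq_bigr => C _; rewrite torus_yM mulrzDl.
Qed.

Definition coord_char : character K0 K.
Proof.
exists coord_char_val => [A phi s t|A B phi psi h hphi t].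
  by rewrite coord_char_valM.
suff: GmZ_map h (coord_char_val phi t)
    = coord_char_val psi (torus_fmap h t) by [].
rewrite raddfD raddf_sum raddfMz /coord_char_val torus_x_map; congr (_ + _).
by apply: eq_bigr => C _; rewrite (torus_y_map hphi) -raddfMz.
Defined.

Lemma coord_charE (A : comAlgType F) (phi : {lrmorphism L -> A}) t :
  charZ coord_char phi t
  = torus_x t *~ n + \sum_(C in Phi) torus_y phi C t *~ f C.
Proof. by []. Qed.

Lemma char_coord_coord_char :
  (forall C, f (bar C) = - f C) -> char_coord coord_char =1 f.
Proof.
move=> fbar D; have cr := coroot_cochar.
apply: deg_unique => [|A phi z]; first exact: cr.
rewrite coord_charE (cochar_x (cr _)) mulr0z mul0rz add0r.
 under eq_bigr => C _ do rewrite (cochar_y (cr _)) -mulrzA.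
have -> : \sum_(C in Phi) z *~ (coroot D C * f C)
   = z *~ \sum_(C in Phi) f C *~ coroot C D.
  rewrite mulrz_sumr; apply: eq_bigr => C _; congr (_ *~ _).
  by rewrite coroot_sym mulrzz mulrC.
by rewrite sum_coroot fbar opprK; case: ifP.
Qed.

Lemma char_weight_coord_char :
  char_weight coord_char = n *+ 2 + \sum_(C in Phi) f C.
Proof.
apply: deg_unique => [|A phi z]; first exact: wt_cochar.
rewrite coord_charE (cochar_x wt_cochar) [RHS]mulrzDr mulrz_sumr; congr (_ + _).
  by rewrite -mulrzA mulr_natl.
by apply: eq_bigr => C _; rewrite (cochar_y wt_cochar).
Qed.

End CharOfCoord.

End CMType.

End TorusCoordinates.

(** * Complex conjugation on the Galois closure *)

(** Choose a primitive element w and a complex root r of its minimal polynomial, and send p(w) to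
    p(r). *)
Lemma algC_embedding (L : fieldExtType rat) :
  separable 1 {:L} -> exists tau : {rmorphism L -> algC}, True.
Proof.
move=> sepL; have wE := eq_adjoin_separable_generator sepL (sub1v _).
set w := separable_generator 1 {:L} in wE.
have [mu muE] := polyOver1P (minPolyOver 1%AS w).
have [r /= r_root] : exists r : algC, root (map_poly ratr mu) r.
  apply/closed_rootP; rewrite size_map_poly -(size_map_poly (in_alg L)) -muE.
  by rewrite size_minPoly.
pose hw (p : {poly rat}) : L := (map_poly (in_alg L) p).[w].
pose hr (p : {poly rat}) : algC := (map_poly ratr p).[r].
have hwr p q : hw p = hw q -> hr p = hr q.
  move=> /eqP; rewrite -subr_eq0 -hornerN -hornerD -rmorphB => pq.
  apply/eqP; rewrite -subr_eq0 -hornerN -hornerD -rmorphB.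
  have : minPoly 1 w %| map_poly (in_alg L) (p - q).
    by apply: minPoly_dvdp => //; apply/polyOver1P; exists (p - q).
  rewrite muE dvdp_map => /dvdpP[s ->].
  by rewrite rmorphM hornerM (eqP r_root) mulr0.
have hwS x : exists p, x = hw p.
  have /Fadjoin_polyP[p /polyOver1P[q ->] ->] : x \in <<1; w>>%VS.
    by rewrite -wE memvf.
  by exists q.
pose f x := hr (sval (cid (hwS x))).
have fE p : f (hw p) = hr p.
  by apply: hwr; case: cid.
have fB : zmod_morphism f.
  move=> x y; have [[p ->] [q ->]] := (hwS x, hwS y).
  have -> : hw p - hw q = hw (p - q) by rewrite /hw rmorphB hornerD hornerN.
  by rewrite !fE /hr rmorphB hornerD hornerN.
have fM : GRing.monoid_morphism f.
  split=> [|x y].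
    by have := fE 1; rewrite /hw /hr !rmorph1 !hornerC.
  have [[p ->] [q ->]] := (hwS x, hwS y).
  have -> : hw p * hw q = hw (p * q) by rewrite /hw rmorphM hornerM.
  by rewrite !fE /hr rmorphM hornerM.
pose aF := GRing.isZmodMorphism.Build _ _ f fB.
pose mF := GRing.isMonoidMorphism.Build _ _ f fM.
pose tau : {rmorphism L -> algC} := HB.pack f aF mF.
by exists tau.
Qed.

Section CM.
Variables (L : splittingFieldType rat) (K0 K : {subfield L}).
Local Notation Gam := (gal_of {:L}).
Local Notation N := 'Gal({:L} / K)%g.
Local Notation N0 := 'Gal({:L} / K0)%g.
Hypotheses (K_CM : CM_field K) (K0_max : maximal_totally_real_subfield K0 K).
Hypothesis L_closure : is_galois_closure K.

Lemma galois_closure : galois 1 {:L}.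
Proof. by case: L_closure. Qed.

Let galK : galois K {:L}.
Proof. by apply: galoisS galois_closure; rewrite sub1v subvf. Qed.
Let galK0 : galois K0 {:L}.
Proof. by apply: galoisS galois_closure; rewrite sub1v subvf. Qed.

Lemma CM_embedding : exists tau : {rmorphism L -> algC}, True.
Proof. by apply: algC_embedding; have /and3P[] := galois_closure. Qed.

(** By maximality K0 contains the field E of the CM condition, and K0 differs from K because K has
    no real embedding; so in [K : K0] [K0 : E] = 2 the first factor is 2. *)
Lemma CM_degree : \dim (vspaceOver K0 K) = 2%N.
Proof.
have [imK [E [sEK reE dimE]]] := K_CM; have [sK0K reK0 maxK0] := K0_max.
have sEK0 := maxK0 E sEK reE.
rewrite dim_aspaceOver //.
have K0K : K0 <> K.
  move=> e; have [tau _] := CM_embedding.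
  have [x] := imK (tau \o vsval); rewrite /= => /negP; apply.
  have xK0 : vsval x \in K0 by rewrite e subvsP.
  by have := reK0 (tau \o vsval) (Subvs xK0).
have dimK := dim_sup_field sK0K.
have dimK0 := dim_sup_field sEK0.
have dimKE := dim_sup_field sEK.
have E0 := adim_gt0 E.
have : (\dim_K0 K * \dim_E K0)%N = 2%N.
  by apply/eqP; rewrite -(eqn_pmul2r E0) -mulnA -dimK0 -dimK dimKE dimE.
have : \dim_K0 K <> 1%N.
  move=> d1; apply: K0K; apply/val_inj/eqP; rewrite /= eqEdim sK0K.
  by rewrite dimK d1 mul1n leqnn.
by move: (\dim_K0 K) (\dim_E K0) => [|[|[|a]]] [|[|b]]; lia.
Qed.

(** Gal(L/K) has index [K : K0] = 2 in Gal(L/K0), so its complement there is a single coset. *)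
Lemma index2_mem (a b : Gam) :
  a \in N0 -> b \in N0 -> a \notin N -> b \notin N ->
  (a * b^-1 \in N)%g.
Proof.
move=> aN0 bN0 aN bN; have [sK0K _ _] := K0_max.
have sNN0 : N \subset N0 by exact: galS.
have cN : #|N0| = (2 * #|N|)%N.
  rewrite -!galois_dim // -CM_degree dim_aspaceOver //.
  apply/eqP; rewrite -(eqn_pmul2r (adim_gt0 K0)).
  rewrite -(dim_sup_field (subvf K0)) mulnAC -(dim_sup_field sK0K) mulnC.
  by rewrite -(dim_sup_field (subvf K)).
have disj : [disjoint N & (N :* b)%g].
  rewrite -setI_eq0; apply/eqP/setP=> x; rewrite !inE mem_rcoset.
  apply/negP=> /andP[xN xbN]; case/negP: bN.
  by have := groupM (groupVr xbN) xN; rewrite invMg invgK mulgKV.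
have : N :|: (N :* b)%g == N0.
  rewrite eqEcard subUset sNN0 mul_subG ?sub1set //=.
  rewrite cardsU (disjoint_setI0 disj) cards0 subn0 card_rcoset cN.
  by rewrite mul2n addnn.
by move=> /eqP/setP/(_ a); rewrite aN0 inE (negPf aN) mem_rcoset.
Qed.

Lemma CM_conjugation : exists iota : Gam,
  [/\ iota \in N0, exists2 y, y \in K & iota y != y,
      forall g : Gam, (iota * g = g * iota)%g & (iota * iota = 1)%g].
Proof.
have [tau _] := CM_embedding.
have [iota0 iota0E] := restrict_aut_to_normal_num_field tau Num.conj.
have kh : kHom 1 {:L} (linfun iota0).
  rewrite k1HomE; apply/ahom_inP; split=> [x y _ _|]; rewrite !lfunE /=.
    by rewrite rmorphM.
  by rewrite rmorph1.
have [||iota _ iotaE] := @kHom_to_gal _ _ 1%AS {:L}%AS {:L}%AS _ _ _ kh.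
- by rewrite sub1v subvf.
- by have /and3P[] := galois_closure.
have tauE x : tau (iota x) = (tau x)^*.
  by rewrite -iotaE ?memvf // lfunE -iota0E.
have [imK _] := K_CM; have [sK0K reK0 _] := K0_max.
have real_fix x : (iota x == x) = (tau x \is Num.real).
  by rewrite CrealE -tauE (inj_eq (fmorph_inj tau)).
have fixK0 (g : Gam) x : x \in K0 -> iota (g x) = g x.
  move=> xK0; apply/eqP; rewrite real_fix.
  exact: (reK0 (tau \o (g \o vsval)) (Subvs xK0)).
have moveK (g : Gam) : exists2 x, x \in K & iota (g x) != g x.
  have [x] := imK (tau \o (g \o vsval)); rewrite /= -real_fix => xr.
  by exists (vsval x); rewrite ?subvsP.
(* [ic g] is the complex conjugation attached to the embedding tau o g. It fixes K0, which is
   totally real, and moves K, which is totally imaginary. *)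
pose ic (g : Gam) := (g * iota * g^-1)%g.
have icE g x : ic g x = (g^-1)%g (iota (g x)) by rewrite !galM ?memvf.
have icN0 g : ic g \in N0.
  rewrite gal_kHom ?subvf //; apply/kAHomP=> x xK0.
  by rewrite icE fixK0 // -galM ?memvf // mulgV gal_id.
have icN g : ic g \notin N.
  have [x xK] := moveK g; apply: contra => gN.
  have := fixed_gal (subvf _) gN xK; rewrite icE => /(congr1 g).
  by rewrite -galM ?memvf // mulVg gal_id => ->.
exists iota; split.
- by have := icN0 1%g; rewrite /ic mul1g invg1 mulg1.
- by have [y yK] := moveK 1%g; rewrite gal_id; exists y.
(* This commutator lies in every conjugate of Gal(L/K), and these have        *)
(* trivial intersection because L is the Galois closure of K.                 *)
- move=> g; pose c := (ic g * iota^-1)%g.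
  have cN h : (h * c * h^-1)%g \in N.
    have -> : (h * c * h^-1 = ic (h * g) * (ic h)^-1)%g.
      by rewrite /c /ic !invMg !invgK !mulgA !mulgKV.
    exact: index2_mem.
  have cC : c \in gcore N [set: Gam].
    by apply/bigcapP=> h _; rewrite mem_conjg conjgE invgK mulgA cN.
  have sKE : (K <= fixedField (gcore N [set: Gam]))%VS.
    by rewrite -galois_connection ?gcore_sub ?subvf.
  have galE : galois 1 (fixedField (gcore N [set: Gam])).
    apply: (@normal_fixedField_galois _ L {:L}%AS 1%AS galois_closure
              [group of gcore N [set: Gam]]).
    by rewrite gal_all gcore_normal ?subsetT.
  have /(congr1 val)/= EL := L_closure.2 _ sKE galE.
  have c1 : c = 1%g.
    apply/eqP/gal_eqP=> x _; rewrite gal_id.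
    have /fixedFieldP : x \in fixedField (gcore N [set: Gam]).
      by rewrite EL memvf.
    by move=> /(_ (memvf _)) ->.
  move: c1 => /(canRL (mulgKV _)).
  by rewrite mul1g /ic => /(canRL (mulgKV _)) <-.
apply/eqP/gal_eqP=> x _; rewrite gal_id galM ?memvf //.
by apply: (fmorph_inj tau); rewrite !tauE conjCK.
Qed.

End CM.

Theorem theorem1p3 (L : splittingFieldType rat) (K0 K : {subfield L})
    (K_CM : CM_field K)
    (K0_max : maximal_totally_real_subfield K0 K)
    (L_closure : is_galois_closure K) :
  (exists f : H1 (character_module K0 K) -> 'Z_2,
     {morph f : x y / abD x y >-> x + y} /\ injective f) /\
  ((forall h : H1 (character_module K0 K), h = ab0) <->
   (exists2 g : gal_of {:L}, g \in ('Gal({:L} / 1))%g &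
      odd #|double_cosets <[g]>%g ('Gal({:L} / 1))%g ('Gal({:L} / K))%g|)).
Proof.
have galL := galois_closure L_closure.
have deg2 := CM_degree K_CM K0_max L_closure.
have [iota [iotaK0 iotaK iotaC iota2]] := CM_conjugation K_CM K0_max L_closure.
have jK := @barK _ _ K iota iota2.
have [Phi PhiP] := involution_transversal jK (bar_neq iotaK iotaC).
pose wt := @char_weight _ _ K0 K galL deg2 iota iotaK0 iotaK iotaC.
pose co := @char_coord _ _ K0 K galL deg2 iota iotaK0 iotaK iotaC.
have [||||||||||||||F H] := @H1_of_coordinates _ (character_module K0 K)
  (embeddings K) (@emb_act _ _ K) iota Phi (emb_of K 1%g) wt co.
- exact: emb_act1.
- exact: emb_actM.
- by move=> C; exists (emb_repr C); rewrite emb_actE mul1g emb_reprK.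
- exact: iotaC.
- exact: iota2.
- exact: PhiP.
- exact: char_weightD.
- exact: char_coordD.
- exact: char_weight_act.
- by move=> chi g C; apply: char_coord_act.
- by move=> chi C; apply: char_coord_bar.
- move=> chi; eexists; exact: char_weightE.
- exact: char_coord_inj.
- move=> k f fbar; exists (coord_char K0 Phi k f).
  by split; [apply: char_weight_coord_char | apply: char_coord_coord_char].
split=> //; apply: (iff_trans H); rewrite gal_all.
(* Both parities are the sign of g as a permutation of the embeddings. *)
have oddE g : odd #|double_cosets <[g]>%g [set: gal_of {:L}] 'Gal({:L} / K)%g|
    = odd #|sign_changes (@emb_act _ _ K) Phi g|.
  rewrite (odd_double_cosets g jK PhiP) (odd_perm_sign_changes jK PhiP).
    by congr (odd #|pred_of_set _|); apply/setP=> C; rewrite !inE permE.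
  by move=> C; rewrite !permE /bar -!emb_actM iotaC.
by split=> [[g]|[g _]]; exists g; rewrite ?inE ?oddE // -oddE.
Qed.
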